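(* Let $K$ be a non-archimedean local field of characteristic $p>0$, with ring of integers $\mathcal{O}_K$, uniformizer $\pi$ and residue field $\mathbb{F}_q$. Let $k$ be a positive integer and $l>1$ an integer such that $p\nmid l$, $p\mid (k+l+1)$ and $1+\bar l\le p$, where $\bar l$ is the residue of $l$ modulo $p$. Let $t\in K$ be such that $t^{k+1}$ is the $p$-th power of a unit of $\mathcal{O}_K$. Consider the hybrid polynomial $$g(x,y,z)=x^p+yz^l\sum_{i=0}^{k}\binom{k+1}{i+1}y^i(tz-y)^{k-i}.$$ Then for every multiplicative character $\chi$ of $\mathcal{O}_K^\times$, $Z_g(s,\chi)$ is a rational function of $q^{-s}$; more precisely, for $\mathrm{Re}(s)>0$, $$Z_g(s,\chi)=\frac{L(q^{-s},\chi)}{(1-q^{-1-s})(1-q^{-((k+l+1)/p+2)-(k+l+1)s})(1-q^{-p-(k+1)-(k+1)ps})(1-q^{-p-l-pls})},$$ where $L(T,\chi)$ is a polynomial in $T$ with complex coefficients.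
   Context: For $x\in K$, $\mathrm{ord}(x)$ is the valuation normalized by $\mathrm{ord}(\pi)=1$, $|x|=q^{-\mathrm{ord}(x)}$, and the angular component is $ac(x)=x\pi^{-\mathrm{ord}(x)}$. For a multiplicative character $\chi:\mathcal{O}_K^\times\to\mathbb{C}^\times$ one sets $\chi(0)=0$. For a non-constant $f\in\mathcal{O}_K[x_1,\dots,x_n]$ and $\mathrm{Re}(s)>0$, Igusa's local zeta function is $Z_f(s,\chi)=\int_{\mathcal{O}_K^n}\chi(ac\, f(x))|f(x)|^s|dx|$, where $|dx|$ is the Haar measure on $K^n$ normalized so that $\mathcal{O}_K^n$ has measure $1$. *)

(* Defs.v *)
From HB Require Import structures.
From mathcomp Require Import all_boot all_order all_algebra.
From mathcomp Require Import all_classical all_reals all_analysis.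
From mathcomp Require Import complex.

Set Implicit Arguments.
Unset Strict Implicit.
Unset Printing Implicit Defensive.

Import Order.TTheory GRing.Theory Num.Theory.
Local Open Scope ring_scope.
Local Open Scope classical_set_scope.

(*   ord : K -> int, meaningful on K^x; ord 0 = +oo is encoded by vle.       *)

Definition vle (K : fieldType) (ord : K -> int) (m : int) (x : K) : bool :=
  (x == 0) || (m <= ord x).

Definition in_OK (K : fieldType) (ord : K -> int) (x : K) : bool := vle ord 0 x.
Definition is_unitK (K : fieldType) (ord : K -> int) (x : K) : bool :=
  (x != 0) && (ord x == 0).

Record nonarch_local_field (K : fieldType) (p q : nat) (ord : K -> int) (pi : K)
  : Prop := NonarchLocalField {
  ord_mul : forall x y : K, x != 0 -> y != 0 -> ord (x * y) = ord x + ord y;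
  ord_add : forall (m : int) (x y : K), vle ord m x -> vle ord m y -> vle ord m (x + y);
  pi_neq0 : pi != 0;
  ord_pi : ord pi = 1;
  char_K : p \in [pchar K];
  residue_card : exists reps : seq K,
      [/\ size reps = q, all (in_OK ord) reps,
          uniq reps,
          {in reps &, forall r r', vle ord 1 (r - r') -> r = r'} &
          forall x, in_OK ord x -> exists2 r, r \in reps & vle ord 1 (x - r)];
  complete : forall u : nat -> K,
      (forall m : int, exists N, forall i j, (N <= i)%N -> (N <= j)%N ->
          vle ord m (u i - u j)) ->
      exists l : K, forall m : int, exists N, forall i, (N <= i)%N ->
          vle ord m (u i - l)
}.

(* K as a pointed type (base point 0), needed to build a measurable type *)
Definition ptK (K : fieldType) : Type := K.
HB.instance Definition _ (K : fieldType) := Choice.on (ptK K).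
HB.instance Definition _ (K : fieldType) := isPointed.Build (ptK K) (0 : K).

Definition vball (K : fieldType) (ord : K -> int) (a : K) (m : int) : set (ptK K) :=
  [set x : ptK K | vle ord m ((x : K) - a)].

Definition vballs (K : fieldType) (ord : K -> int) : set (set (ptK K)) :=
  [set B | exists a m, B = vball ord a m].

(* K with its Borel sigma-algebra (generated by the balls, which form a
   basis of the valuation topology) *)
Definition Kmeas (K : fieldType) (ord : K -> int) := g_sigma_algebraType (vballs ord).

(* Haar measure on K normalized by mu(O_K) = 1: mu(a + pi^m O_K) = q^(-m). *)
Definition haar_measure (R : realType) (K : fieldType) (q : nat) (ord : K -> int)
  (mu : set (Kmeas ord) -> \bar R) : Prop :=
  forall (a : K) (m : int), mu (vball ord a m) = ((q%:R : R) ^ (- m))%:E.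

Local Open Scope complex_scope.

Definition qpow (R : realType) (q : R) (z : R[i]) : R[i] :=
  (expR (complex.Re z * ln q))%:C * ((cos (complex.Im z * ln q)) +i* (sin (complex.Im z * ln q))).

(* |x|^s = q^(- ord(x) s) for x <> 0, and |0|^s = 0 (Re s > 0) *)
Definition abs_pow (R : realType) (K : fieldType) (q : nat) (ord : K -> int)
  (x : K) (s : R[i]) : R[i] :=
  if x == 0 then 0 else qpow (q%:R) (- ((ord x)%:~R * s)).

Definition ac (K : fieldType) (ord : K -> int) (pi : K) (x : K) : K :=
  x * pi ^ (- ord x).

(* a multiplicative (continuous) character chi : O_K^x -> C^x, given as a
   function on K whose values off O_K^x are irrelevant *)
Definition mult_character (R : realType) (K : fieldType) (ord : K -> int)
  (chi : K -> R[i]) : Prop :=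
  [/\ forall u v, is_unitK ord u -> is_unitK ord v -> chi (u * v) = chi u * chi v,
      forall u, is_unitK ord u -> chi u != 0 &
      (* continuity: chi is trivial on 1 + pi^e O_K for some e *)
      exists e : nat, forall u, is_unitK ord u -> vle ord e%:Z (u - 1) -> chi u = 1].

Definition chi0 (R : realType) (K : fieldType) (chi : K -> R[i]) (x : K) : R[i] :=
  if x == 0 then 0 else chi x.

Definition cintegral d (T : measurableType d) (R : realType)
  (mu : {measure set T -> \bar R}) (D : set T) (F : T -> R[i]) : R[i] :=
  (Rintegral mu D (fun x => complex.Re (F x)))%:C
  + 'i * (Rintegral mu D (fun x => complex.Im (F x)))%:C.

Definition OK3 (K : fieldType) (ord : K -> int)
  : set ((Kmeas ord * Kmeas ord) * Kmeas ord) :=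
  [set x | [/\ in_OK ord (x.1.1 : K), in_OK ord (x.1.2 : K) & in_OK ord (x.2 : K)]].

Arguments OK3 {K} ord _.

Definition igusa_zeta3 (R : realType) (K : fieldType) (q : nat) (ord : K -> int)
  (pi : K) (mu : {sigma_finite_measure set (Kmeas ord) -> \bar R}) (f : K -> K -> K -> K)
  (chi : K -> R[i]) (s : R[i]) : R[i] :=
  cintegral ((mu \x mu) \x mu)%E (OK3 ord)
    (fun x => chi0 chi (ac ord pi (f x.1.1 x.1.2 x.2))
              * abs_pow q ord (f x.1.1 x.1.2 x.2) s).

Definition hybrid_g (K : fieldType) (p k l : nat) (t : K) (x y z : K) : K :=
  x ^+ p + y * z ^+ l *
    \sum_(i < k.+1) ('C(k.+1, i.+1))%:R * y ^+ i * (t * z - y) ^+ (k - i).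

(* Main.v *)
Require Import Defs.
From HB Require Import structures.
From mathcomp Require Import all_boot all_order all_algebra.
From mathcomp Require Import all_classical all_reals all_analysis.
From mathcomp Require Import measurable_realfun complex.
From mathcomp Require Import zify ring.
Import Order.TTheory GRing.Theory Num.Theory.
Import numFieldNormedType.Exports.
Local Open Scope ring_scope.

Set Implicit Arguments.
Unset Strict Implicit.
Unset Printing Implicit Defensive.

(* The sum in [g] telescopes: [g = x^p + z^l ((t z)^n - (t z - y)^n)] with
   [n = k + 1], and since [t^n = u^p] and [p m = l + n], Frobenius gives
   [g = (x + u z^m)^p - z^l (t z - y)^n].  The map
   [(x, y, z) |-> (x + u z^m, t z - y, z)] preserves Haar measure on the unit
   polydisc, so the problem reduces to [h = x^p - z^l w^n].

   The zeta function is the power series in [T = q^(-s)] whose [j]-th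
   coefficient is a combination, over classes [r] of units mod [pi^e], of the
   volumes of [h^(-1) (pi^j r + pi^(j+e) O)], where [chi] is trivial on
   [1 + pi^e O].  The polynomial [h] is quasi-homogeneous for the dilations with
   exponents [(m,1,1)], [(n,p,0)] and [(l,0,p)] on [(x,w,z)]; each of the three
   factors [1 - q^(-...) T^(...)] removes from the unit polydisc the image of a
   dilation.  What is left are pieces on which [ord w] and [ord z] are fixed,
   or [ord x] is fixed and [h] is dominated by [x^p].  On the former [dh/dz] has
   constant order because [l] is prime to [p], so the volumes are eventually
   geometric of ratio [1/q], and [1 - T/q] makes the series a polynomial. *)

(** * Valuations and residue systems *)

(** In characteristic p the derivative of x^p is zero, so the level sets of h cannot be solved for
    x; they are solved for z, which works only where the orders of w and z are both under control.
    The obstruction is the pair of lines x = w = 0 and x = z = 0, which meet at the origin. The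
    dilation with exponents (m,1,1) contracts the polydisc to the origin, and each of the other two
    contracts it to one of the lines. The constants m + 2, p + n and p + l are the sums of the three
    exponents, that is, the orders of the Jacobians, while p m, n p and p l are the orders of the
    factors by which h gets multiplied.

    Volumes are computed as averages over residue classes modulo pi^M, exact once M >= j + e. No
    single M serves every j, so recurrences are stated for functions of M and j with a margin
    between the two, and are then turned into statements on truncated generating polynomials.
    Integration enters only to identify these averages with Haar integrals and to compare partial
    sums with the zeta integral. *)

Section Valuation.
Variables (K : fieldType) (p q : nat) (ord : K -> int) (pi : K).
Hypothesis HK : nonarch_local_field p q ord pi.

Local Notation vl n x := (vle ord (n : nat)%:Z x).
Local Notation O x := (in_OK ord x).

Lemma ordM x y : x != 0 -> y != 0 -> ord (x * y) = ord x + ord y.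
Proof. exact: (ord_mul HK). Qed.

Lemma ord_one : ord 1 = 0.
Proof.
have := ordM (oner_neq0 K) (oner_neq0 K); rewrite mulr1 => h.
by apply: (addrI (ord 1)); rewrite addr0 -h.
Qed.

Lemma ordX x n : x != 0 -> ord (x ^+ n) = ord x *+ n.
Proof.
move=> x0; elim: n => [|n IH]; first by rewrite expr0 mulr0n ord_one.
by rewrite exprS ordM ?expf_neq0// IH mulrS.
Qed.

Lemma ordV x : x != 0 -> ord x^-1 = - ord x.
Proof.
move=> x0; apply/eqP; rewrite -addr_eq0 -ordM ?invr_eq0//.
by rewrite mulVf// ord_one.
Qed.

Lemma ordN1 : ord (-1) = 0.
Proof.
have n0 : (-1 : K) != 0 by rewrite oppr_eq0 oner_neq0.
have := ordM n0 n0; rewrite mulrNN mulr1 ord_one; lia.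
Qed.

Lemma pi0 : pi != 0. Proof. exact: (pi_neq0 HK). Qed.

Lemma piX0 n : pi ^+ n != 0. Proof. by rewrite expf_neq0 ?pi0. Qed.

Lemma ord_piX n : ord (pi ^+ n) = n%:Z.
Proof. by rewrite ordX ?pi0// (ord_pi HK) -[RHS]natz. Qed.

Lemma vle0 m : vle ord m 0. Proof. by rewrite /vle eqxx. Qed.

Lemma vle_nz m x : x != 0 -> vle ord m x = (m <= ord x).
Proof. by rewrite /vle => /negPf->. Qed.

Lemma vle_trans m m' x : m' <= m -> vle ord m x -> vle ord m' x.
Proof. by rewrite /vle => h /orP[->//|h']; rewrite (le_trans h h') orbT. Qed.

Lemma vleM m m' x y : vle ord m x -> vle ord m' y -> vle ord (m + m') (x * y).
Proof.
have [->|x0] := eqVneq x 0; first by rewrite mul0r !vle0.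
have [->|y0] := eqVneq y 0; first by rewrite mulr0 !vle0.
rewrite !vle_nz ?mulf_neq0// ordM//; exact: lerD.
Qed.

Lemma vleD m x y : vle ord m x -> vle ord m y -> vle ord m (x + y).
Proof. exact: (ord_add HK). Qed.

Lemma vleN m x : vle ord m (- x) = vle ord m x.
Proof.
have [->|x0] := eqVneq x 0; first by rewrite oppr0.
rewrite !vle_nz ?oppr_eq0// -mulN1r ordM ?oppr_eq0 ?oner_neq0//.
by rewrite ordN1 add0r.
Qed.

Lemma vleB m x y : vle ord m x -> vle ord m y -> vle ord m (x - y).
Proof. by move=> hx hy; apply: vleD => //; rewrite vleN. Qed.

Lemma vle_distC m x y : vle ord m (x - y) = vle ord m (y - x).
Proof. by rewrite -vleN opprB. Qed.

Lemma vle_addr m x y : vle ord m y -> vle ord m (x + y) = vle ord m x.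
Proof.
move=> hy; apply/idP/idP => h; last exact: vleD.
by rewrite -(addrK y x); apply: vleB.
Qed.

Lemma vle_congr m x y : vle ord m (x - y) -> vle ord m x = vle ord m y.
Proof. by move=> h; rewrite -(subrK y x) addrC vle_addr. Qed.

Lemma vle_scale u m x : u != 0 -> vle ord (ord u + m) (u * x) = vle ord m x.
Proof.
move=> u0; have [->|x0] := eqVneq x 0; first by rewrite mulr0 !vle0.
by rewrite !vle_nz ?mulf_neq0// ordM// lerD2l.
Qed.

Lemma vle_piX n m x : vle ord (n%:Z + m) (pi ^+ n * x) = vle ord m x.
Proof. by rewrite -[n%:Z]ord_piX vle_scale// piX0. Qed.

Lemma OM x y : O x -> O y -> O (x * y).
Proof. by move=> hx hy; have := vleM hx hy; rewrite addr0. Qed.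

Lemma vleMl m x y : O x -> vle ord m y -> vle ord m (x * y).
Proof. by move=> hx hy; have := vleM hx hy; rewrite add0r. Qed.

Lemma O1 : O 1. Proof. by rewrite /in_OK vle_nz ?oner_neq0// ord_one. Qed.

Lemma OX x n : O x -> O (x ^+ n).
Proof.
by move=> h; elim: n => [|n IH]; [exact: O1 | rewrite exprS OM].
Qed.

Lemma Opi n : O (pi ^+ n).
Proof. by rewrite /in_OK vle_nz ?piX0// ord_piX. Qed.

Lemma vle_O n x : vl n x -> O x.
Proof. exact: vle_trans. Qed.

Lemma Onat n : O n%:R.
Proof. by elim: n => [|n IH]; [exact: vle0 | rewrite mulrS; exact: (vleD O1 IH)]. Qed.

Lemma vle_div n x : vl n x -> {y | O y & x = pi ^+ n * y}.
Proof.
move=> h; exists (x / pi ^+ n); last by rewrite mulrC divfK ?piX0.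
by rewrite /in_OK -(vle_piX n) addr0 mulrC divfK ?piX0.
Qed.

(** Bezout gives a natural number a with a l = 1 in K, because p is 0 there. Both a and l have
    nonnegative order and the two orders add up to 0. *)
Lemma ord_natr l : ~~ (p %| l)%N -> is_unitK ord (l%:R : K).
Proof.
move=> pl; have pp := pcharf_prime (char_K HK).
have l0 : l%:R != 0 :> K by rewrite -(dvdn_pcharf (char_K HK)).
rewrite /is_unitK l0 eq_le/=.
have cop : coprime l p by rewrite coprime_sym prime_coprime.
have lpos : (0 < l)%N by case: (l) pl => //; rewrite dvdn0.
case: (egcdnP p lpos) => a b e _.
rewrite (eqP (cop : gcdn l p == 1%N)) in e.
have ae : a%:R * l%:R = 1 :> K.
  rewrite -natrM e natrD natrM.
  by rewrite (pcharf0 (char_K HK)) mulr0 add0r.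
have a0 : a%:R != 0 :> K.
  by apply/eqP => a0; move/eqP: ae; rewrite a0 mul0r eq_sym oner_eq0.
have := Onat l; have := Onat a; rewrite /in_OK !vle_nz//.
have := ordM a0 l0; rewrite ae ord_one; lia.
Qed.

Lemma ord_congr x y : x != 0 -> vle ord (ord x + 1) (y - x) ->
  y != 0 /\ ord y = ord x.
Proof.
move=> x0 h.
have hx : vle ord (ord x) x by rewrite vle_nz.
have nx : ~~ vle ord (ord x + 1) x by rewrite vle_nz//; lia.
have ny : ~~ vle ord (ord x + 1) y by rewrite (vle_congr h).
have y0 : y != 0 by apply: contraNneq ny => ->; exact: vle0.
split=> //.
have : vle ord (ord x) y.
  by rewrite (@vle_congr _ y x)//; apply: vle_trans h; lia.
move: ny; rewrite !vle_nz//; lia.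
Qed.

Lemma vle_subX m x y n : O x -> O y -> vle ord m (x - y) ->
  vle ord m (x ^+ n - y ^+ n).
Proof.
move=> hx hy h; rewrite subrXX mulrC; apply: vleMl => //.
elim/big_ind: _ => [|a b ha hb|i _]; [exact: vle0|exact: vleD|].
by rewrite OM ?OX.
Qed.

Lemma vle_subM m x y x' y' : O y -> O x' ->
  vle ord m (x - x') -> vle ord m (y - y') -> vle ord m (x * y - x' * y').
Proof.
move=> hy hx' h1 h2.
have -> : x * y - x' * y' = y * (x - x') + x' * (y - y') by ring.
by rewrite vleD// vleMl.
Qed.

End Valuation.

(** The set [A] is a parameter because ideals pi^a O need representatives as well as O, see
    [mean_scale]. *)
Definition mod_transversal (K : fieldType) (ord : K -> int) (A : pred K) (M : nat) (s : seq K) :=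
  [/\ uniq s, {in s, forall r, A r},
      {in s &, forall r r', vle ord M%:Z (r - r') -> r = r'} &
      forall x, A x -> exists2 r, r \in s & vle ord M%:Z (x - r)].

Definition mod_periodic (K : fieldType) (ord : K -> int) (M : nat) (T : Type) (F : K -> T) :=
  forall x y, in_OK ord x -> in_OK ord y -> vle ord M%:Z (x - y) -> F x = F y.

(** * Averages over residue classes modulo powers of the uniformizer *)

Section Mean.
Variables (R : realType) (K : fieldType) (p q : nat) (ord : K -> int) (pi : K).
Hypothesis HK : nonarch_local_field p q ord pi.
Variable rs : seq K.
Hypothesis rs_size : size rs = q.
Hypothesis rs_transversal : mod_transversal ord (in_OK ord) 1 rs.

Local Notation vl n x := (vle ord (n : nat)%:Z x).
Local Notation O x := (in_OK ord x).

(** Truncated pi-adic expansions with [n] digits taken from [rs]. *)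
Fixpoint reps (n : nat) : seq K :=
  if n is m.+1 then [seq r + pi ^+ m * r0 | r <- reps m, r0 <- rs] else [:: 0].

Local Notation mod_transversal := (mod_transversal ord).
Local Notation mod_periodic := (mod_periodic ord).

Let rs_O : all (in_OK ord) rs.
Proof. by apply/allP; case: rs_transversal. Qed.

Let rs_uniq : uniq rs.
Proof. by case: rs_transversal. Qed.

Let rs_inj : {in rs &, forall r r', vle ord 1 (r - r') -> r = r'}.
Proof. by case: rs_transversal. Qed.

Let rs_cov x : in_OK ord x -> exists2 r, r \in rs & vle ord 1 (x - r).
Proof. by case: rs_transversal => _ _ _; apply. Qed.

Lemma reps_transversal M : mod_transversal (in_OK ord) M (reps M).
Proof.
elim: M => [|M [u o i c]].
  split=> //=.
  - by move=> r; rewrite inE => /eqP->; exact: vle0.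
  - by move=> r r'; rewrite !inE => /eqP-> /eqP->.
  - by move=> x hx; exists 0; rewrite ?inE// subr0.
have inj : forall r r' a a', r \in reps M -> r' \in reps M -> a \in rs -> a' \in rs ->
    vl M.+1 (r + pi ^+ M * a - (r' + pi ^+ M * a')) -> r = r' /\ a = a'.
  move=> r r' a a' hr hr' ha ha' h.
  have vm : vl M (pi ^+ M * (a - a')).
    by rewrite -[M%:Z]addr0 (vle_piX HK) (vleB HK)//; apply: (allP rs_O).
  have rr : r = r'.
    apply: i => //.
    have -> : r - r' = (r + pi ^+ M * a - (r' + pi ^+ M * a')) - pi ^+ M * (a - a').
      by ring.
    apply: (vleB HK) => //; apply: vle_trans h; lia.
  split=> //; apply: rs_inj => //.
  move: h; rewrite rr.
  have -> : r' + pi ^+ M * a - (r' + pi ^+ M * a') = pi ^+ M * (a - a') by ring.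
  have -> : M.+1%:Z = M%:Z + 1 by lia.
  by rewrite (vle_piX HK).
split.
- rewrite allpairs_uniq// => -[r a] [r' a'] /allpairsP[[? ?] /= [h1 h2 [-> ->]]].
  move=> /allpairsP[[? ?] /= [h3 h4 [-> ->]]] e.
  have [] := inj _ _ _ _ h1 h3 h2 h4; last by move=> -> ->.
  by rewrite e subrr vle0.
- move=> ? /allpairsP[[r a] /= [hr ha ->]].
  apply: (vleD HK); first exact: o.
  by apply: (OM HK); [exact: (Opi HK)|exact: (allP rs_O)].
- move=> ? ? /allpairsP[[r a] /= [hr ha ->]] /allpairsP[[r' a'] /= [hr' ha' ->]] h.
  by have [-> ->] := inj _ _ _ _ hr hr' ha ha' h.
- move=> x hx; have [r hr h] := c x hx.
  have [y hy e] := vle_div HK h; have [a ha h'] := rs_cov hy.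
  exists (r + pi ^+ M * a); first by apply/allpairsP; exists (r, a).
  have -> : x - (r + pi ^+ M * a) = pi ^+ M * (y - a).
    by rewrite opprD addrA e; ring.
  have -> : M.+1%:Z = M%:Z + 1 by lia.
  by rewrite (vle_piX HK).
Qed.

Lemma size_reps M : size (reps M) = (q ^ M)%N.
Proof. by elim: M => //= M IH; rewrite size_allpairs IH rs_size expnSr. Qed.

Definition proj_mod (M : nat) (s : seq K) (x : K) : K :=
  head 0 [seq r <- s | vl M (x - r)].

Lemma proj_modP A M s x : mod_transversal A M s -> (exists2 y, A y & vl M (x - y)) ->
  proj_mod M s x \in s /\ vl M (x - proj_mod M s x).
Proof.
move=> [_ _ _ c] [y Ay hxy]; have [r rs' h] := c y Ay.
rewrite /proj_mod; have : r \in [seq r <- s | vl M (x - r)].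
  rewrite mem_filter rs' andbT.
  have -> : x - r = (x - y) + (y - r) by ring.
  exact: (vleD HK).
case E : [seq _ <- _ | _] => [|a t] //= _.
have : a \in [seq r <- s | vl M (x - r)] by rewrite E mem_head.
by rewrite mem_filter => /andP[].
Qed.

(** Sending each element of [s] to its representative in [s'] is a bijection, and it does not change
    [F]. *)
Lemma transversal_sum (A : pred K) M s s' (F : K -> R) :
  (forall x, A x -> O x) -> mod_transversal A M s -> mod_transversal A M s' ->
  mod_periodic M F -> \sum_(r <- s) F r = \sum_(r <- s') F r.
Proof.
move=> AO ts ts' pF.
have [u a i c] := ts; have [u' a' i' c'] := ts'.
have P r : r \in s -> proj_mod M s' r \in s' /\ vl M (r - proj_mod M s' r).
  move=> hr; apply: proj_modP ts' _.
  by exists r; [exact: a|rewrite subrr vle0].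
have -> : \sum_(r <- s) F r = \sum_(r <- [seq proj_mod M s' r | r <- s]) F r.
  rewrite big_map big_seq [RHS]big_seq; apply: eq_bigr => r hr.
  have [h1 h2] := P r hr; apply: pF => //; apply: AO; [exact: a|exact: a'].
apply: perm_big; apply: uniq_perm => //.
  rewrite map_inj_in_uniq// => r r' hr hr' e; apply: i => //.
  have [_ h2] := P r hr; have [_ h2'] := P r' hr'.
  have -> : r - r' = (r - proj_mod M s' r) - (r' - proj_mod M s' r').
    by rewrite e; ring.
  exact: (vleB HK).
move=> y; apply/mapP/idP => [[r hr ->]|hy]; first by have [] := P r hr.
have [r hr h] := c y (a' y hy); exists r => //.
have [h1 h2] := P r hr; apply: i' => //.
have -> : y - proj_mod M s' r = (y - r) + (r - proj_mod M s' r) by ring.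
exact: (vleD HK).
Qed.

(* An expanding self-map of O is a bijection mod [pi^M], by pigeonhole. *)
Lemma transversal_map M s (f : K -> K) :
  (forall x, O x -> O (f x)) ->
  (forall x y, O x -> O y -> vl M (f x - f y) -> vl M (x - y)) ->
  mod_transversal (in_OK ord) M s -> mod_transversal (in_OK ord) M [seq f r | r <- s].
Proof.
move=> fO fi ts; have [u a i c] := ts.
have inj r r' : r \in s -> r' \in s -> vl M (f r - f r') -> r = r'.
  by move=> hr hr' h; apply: i => //; apply: fi => //; apply: a.
have P r : r \in s -> proj_mod M s (f r) \in s /\ vl M (f r - proj_mod M s (f r)).
  move=> hr; apply: proj_modP ts _; exists (f r); first exact/fO/a.
  by rewrite subrr vle0.
split.
- rewrite map_inj_in_uniq// => r r' hr hr' e; apply: inj => //.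
  by rewrite e subrr vle0.
- by move=> ? /mapP[r hr ->]; exact/fO/a.
- move=> ? ? /mapP[r hr ->] /mapP[r' hr' ->] h.
  by rewrite (inj r r').
- have um : uniq [seq proj_mod M s (f r) | r <- s].
    rewrite map_inj_in_uniq// => r r' hr hr' e; apply: inj => //.
    have [_ h2] := P r hr; have [_ h2'] := P r' hr'.
    have -> : f r - f r' =
        (f r - proj_mod M s (f r)) - (f r' - proj_mod M s (f r')) by rewrite e; ring.
    exact: (vleB HK).
  have sub : {subset [seq proj_mod M s (f r) | r <- s] <= s}.
    by move=> ? /mapP[r hr ->]; have [] := P r hr.
  have [_ e] := uniq_min_size um sub (eq_leq (esym (size_map _ _))).
  move=> x hx; have [r hr h] := c x hx.
  have : r \in [seq proj_mod M s (f r) | r <- s] by rewrite e.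
  move=> /mapP[r' hr' er]; exists (f r'); first exact: map_f.
  have [_ h2] := P r' hr'.
  have -> : x - f r' = (x - r) - (f r' - r) by ring.
  by apply: (vleB HK) => //; rewrite er.
Qed.

(* For [F] constant mod [pi^M] this is the Haar integral over O, so the level [M]
   may be taken as large as needed. *)
Definition mean (M : nat) (F : K -> R) : R :=
  (q%:R ^+ M)^-1 * \sum_(r <- reps M) F r.

(** The classes of 0 and 1 modulo pi are different. *)
Lemma q_gt1 : (1 < q)%N.
Proof.
rewrite -rs_size.
have [a ha h0] := rs_cov (vle0 ord 0); have [b hb h1] := rs_cov (O1 HK).
have ab : a != b.
  apply/eqP => e; subst b.
  have : vl 1 (1 : K).
    have -> : 1 = (1 - a) - (0 - a) by ring.
    exact: (vleB HK).
  by rewrite vle_nz ?oner_neq0// (ord_one HK).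
case: (rs) ha hb => [//|x [|y t]//].
by rewrite !inE => /eqP ea /eqP eb; rewrite ea eb eqxx in ab.
Qed.

Lemma q_neq0 : q%:R != 0 :> R.
Proof. by rewrite pnatr_eq0 -lt0n ltnW ?q_gt1. Qed.

Lemma eq_mean M F G : (forall x, O x -> F x = G x) -> mean M F = mean M G.
Proof.
move=> e; rewrite /mean big_seq [in RHS]big_seq; congr *%R; apply: eq_bigr => r hr.
by apply: e; have [_ o _ _] := reps_transversal M; exact: o.
Qed.

Lemma meanD M F G : mean M (fun x => F x + G x) = mean M F + mean M G.
Proof. by rewrite /mean big_split mulrDr. Qed.

Lemma meanZ M c F : mean M (fun x => c * F x) = c * mean M F.
Proof. by rewrite /mean -mulr_sumr mulrCA. Qed.

Lemma mean_cst M c : mean M (fun=> c) = c.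
Proof.
rewrite /mean big_const_seq count_predT size_reps iter_addr_0 -[c *+ _]mulr_natr.
by rewrite natrX mulrCA mulVf ?mulr1// expf_neq0// q_neq0.
Qed.

Lemma mean_exchange M N (F : K -> K -> R) :
  mean M (fun x => mean N (F x)) = mean N (fun y => mean M (F^~ y)).
Proof.
by rewrite /mean -!mulr_sumr exchange_big mulrCA.
Qed.

(** Change of variables for a measure-preserving map: by [transversal_map] the images of the
    representatives are again representatives. It is applied to translations, to multiplication by
    units, and to the map [phi] of [mean_one_unit]. *)
Lemma mean_map M (F : K -> R) (f : K -> K) : mod_periodic M F ->
  (forall x, O x -> O (f x)) ->
  (forall x y, O x -> O y -> vl M (f x - f y) -> vl M (x - y)) ->
  mean M (fun x => F (f x)) = mean M F.
Proof.
move=> pF fO fi; rewrite /mean; congr *%R.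
rewrite -(big_map f predT F).
apply: (@transversal_sum (in_OK ord) M) => //; last exact: reps_transversal.
by apply: transversal_map => //; exact: reps_transversal.
Qed.

(** Passing from one level to the next splits every class into q classes on which [F] is unchanged,
    and the normalization absorbs the factor q. *)
Lemma mean_level M N F : mod_periodic M F -> (M <= N)%N -> mean N F = mean M F.
Proof.
move=> pF /subnK<-; elim: (N - M)%N => // n IH.
rewrite -IH addSn /mean /=.
rewrite big_allpairs_dep/=.
transitivity ((q%:R ^+ (n + M).+1)^-1 * \sum_(r <- reps (n + M)) (q%:R * F r) : R).
  congr *%R; rewrite big_seq [RHS]big_seq; apply: eq_bigr => r hr.
  have [_ o _ _] := reps_transversal (n + M).
  transitivity (\sum_(r0 <- rs) F r).
    rewrite big_seq [RHS]big_seq; apply: eq_bigr => a ha.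
    have Oa : O (pi ^+ (n + M) * a).
      by rewrite (OM HK) ?(Opi HK)//; apply: (allP rs_O).
    apply: pF; [by apply: (vleD HK) => //; exact: o| exact: o|].
    rewrite [r + _]addrC addrK.
    apply: (@vle_trans _ _ (n + M)%:Z); first lia.
    by rewrite -[(n + M)%:Z]addr0 (vle_piX HK)//; apply: (allP rs_O).
  by rewrite big_const_seq count_predT rs_size iter_addr_0 mulr_natl.
by rewrite -mulr_sumr mulrA exprSr invfM divfK ?q_neq0.
Qed.

(** Change of variables for a contraction, with Jacobian q^(-a). The function [F] composed with
    multiplication by pi^a is already periodic modulo pi^(M-a), and representatives at that level,
    multiplied by pi^a, represent pi^a O modulo pi^M. *)
Lemma mean_scale M a F : mod_periodic M F -> (a <= M)%N ->
  mean M (fun x => (vl a x)%:R * F x) =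
  (q%:R ^+ a)^-1 * mean M (fun x => F (pi ^+ a * x)).
Proof.
move=> pF aM.
have pG : mod_periodic (M - a) (fun x => F (pi ^+ a * x)).
  move=> x y hx hy h; apply: pF; rewrite ?(OM HK) ?(Opi HK)// -mulrBr.
  have -> : M%:Z = a%:Z + (M - a)%N%:Z by lia.
  by rewrite (vle_piX HK).
rewrite (mean_level pG) ?leq_subr// /mean mulrA -invfM -exprD subnKC//.
congr *%R.
rewrite -(big_map (fun x => pi ^+ a * x) predT F).
transitivity (\sum_(r <- reps M | vl a r) F r).
  rewrite [RHS]big_mkcond; apply: eq_bigr => r _.
  by case: ifP => _; rewrite ?mul1r ?mul0r.
rewrite -[LHS]big_filter.
apply: (@transversal_sum (fun x => vl a x) M _ _ F _ _ _ pF).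
- by move=> x; exact: vle_O.
- have [u o i c] := reps_transversal M; split.
  + exact: filter_uniq.
  + by move=> r; rewrite mem_filter => /andP[].
  + by move=> r r'; rewrite !mem_filter => /andP[_ h] /andP[_ h']; apply: i.
  + move=> x hx; have [r hr h] := c x (vle_O hx); exists r => //.
    rewrite mem_filter hr andbT -(@vle_congr _ _ _ _ _ HK _ x r)//.
    by apply: vle_trans h; lia.
- have [u o i c] := reps_transversal (M - a)%N.
  have eM : M%:Z = a%:Z + (M - a)%N%:Z by lia.
  split.
  + by rewrite map_inj_uniq//; apply: mulfI; exact: (piX0 HK).
  + by move=> ? /mapP[r hr ->]; rewrite -[a%:Z]addr0 (vle_piX HK); exact: o.
  + move=> ? ? /mapP[r hr ->] /mapP[r' hr' ->].
    by rewrite -mulrBr eM (vle_piX HK) => h; rewrite (i r r').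
  + move=> x /(vle_div HK)[y hy ->]; have [r hr h] := c y hy.
    exists (pi ^+ a * r); first exact: map_f.
    by rewrite -mulrBr eM (vle_piX HK).
Qed.

Lemma mean_ball M N c : O c -> (N <= M)%N ->
  mean M (fun y => (vl N (y - c))%:R) = (q%:R ^+ N)^-1.
Proof.
move=> hc NM.
have pN : mod_periodic M (fun y => (vl N y)%:R : R).
  move=> x y hx hy h /=; congr (nat_of_bool _)%:R; apply: (vle_congr HK).
  by apply: vle_trans h; lia.
rewrite (@mean_map M (fun y => (vl N y)%:R) (fun y => y - c))//.
- transitivity (mean M (fun x => (vl N x)%:R * 1)).
    by apply: eq_mean => x _; rewrite mulr1.
  by rewrite mean_scale// mean_cst mulr1.
- by move=> x hx; exact: (vleB HK).
- by move=> x y _ _; rewrite opprB addrA subrK.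
Qed.

End Mean.

(** * Weighted volumes of level sets of h *)

Section Weighted.
Variables (R : realType) (K : fieldType) (p q : nat) (ord : K -> int) (pi : K).
Hypothesis HK : nonarch_local_field p q ord pi.
Variable rs : seq K.
Hypothesis rs_size : size rs = q.
Hypothesis rs_transversal : mod_transversal ord (in_OK ord) 1 rs.
Variables (l n e : nat) (r : K).
Hypothesis l_unit : is_unitK ord (l%:R : K).
Hypothesis e_gt0 : (0 < e)%N.
Hypothesis r_unit : is_unitK ord r.

Local Notation vl n x := (vle ord (n : nat)%:Z x).
Local Notation O x := (in_OK ord x).
Local Notation mean := (mean (R := R) q pi rs).
Local Notation mod_periodic := (mod_periodic ord).

Let r0 : r != 0. Proof. by case/andP: r_unit. Qed.
Let ordr : ord r = 0. Proof. by case/andP: r_unit => _ /eqP. Qed.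
Let Or : O r. Proof. by rewrite /in_OK vle_nz// ordr. Qed.

(** For a unit [r] and e > 0 these are the x of order j whose angular component is congruent to r
    modulo pi^e. A character trivial on 1 + pi^e O therefore takes the single value [chi r] on their
    angular components. *)
Definition mem_vball (j : nat) (x : K) : bool := vl (j + e) (x - pi ^+ j * r).

Definition in_ball (j : nat) (x : K) : R := (mem_vball j x)%:R.

Lemma mem_vball_ord j x : mem_vball j x -> x != 0 /\ ord x = j.
Proof.
move=> h; have h0 : pi ^+ j * r != 0 by rewrite mulf_neq0 ?(piX0 HK).
have oj : ord (pi ^+ j * r) = j.
  by rewrite (ordM HK) ?(piX0 HK)// (ord_piX HK) ordr addr0.
have [] := ord_congr HK h0 (y := x); last by rewrite oj.
by rewrite oj; apply: vle_trans h; rewrite PoszD lerD2l lez_nat.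
Qed.

Lemma mem_vball_pi a j x : mem_vball (a + j) (pi ^+ a * x) = mem_vball j x.
Proof.
rewrite /mem_vball exprD -mulrA -mulrBr -[RHS](vle_piX HK a).
by rewrite -addnA PoszD.
Qed.

Lemma in_ball_eq0 j x : ~~ mem_vball j x -> in_ball j x = 0.
Proof. by rewrite /in_ball => /negPf->. Qed.

Lemma mem_vball_congr j x y : vl (j + e) (x - y) -> mem_vball j x = mem_vball j y.
Proof.
move=> h; apply: (vle_congr HK).
by have -> : x - pi ^+ j * r - (y - pi ^+ j * r) = x - y by ring.
Qed.

Lemma mem_vball0 a j x : vl a x -> (j < a)%N -> mem_vball j x = false.
Proof.
move=> h ja; apply/negP => /mem_vball_ord[x0 ox].
by move: h; rewrite vle_nz// ox lez_nat leqNgt ja.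
Qed.

Definition poly_h (x w z : K) : K := x ^+ p - z ^+ l * w ^+ n.

Lemma poly_h_congr M x w z x' w' z' :
  O x -> O w -> O z -> O x' -> O w' -> O z' ->
  vl M (x - x') -> vl M (w - w') -> vl M (z - z') ->
  vl M (poly_h x w z - poly_h x' w' z').
Proof.
move=> hx hw hz hx' hw' hz' h1 h2 h3; rewrite /poly_h.
have -> : x ^+ p - z ^+ l * w ^+ n - (x' ^+ p - z' ^+ l * w' ^+ n) =
  (x ^+ p - x' ^+ p) - (z ^+ l * w ^+ n - z' ^+ l * w' ^+ n) by ring.
apply: (vleB HK); first exact: (vle_subX HK).
by apply: (vle_subM HK); rewrite ?(OX HK)//; apply: (vle_subX HK).
Qed.

Lemma poly_h_O x w z : O x -> O w -> O z -> O (poly_h x w z).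
Proof.
by move=> hx hw hz; apply: (vleB HK); [|apply: (OM HK)]; exact: (OX HK).
Qed.

Lemma poly_h_scale a b c x w z : (p * a = l * c + n * b)%N ->
  poly_h (pi ^+ a * x) (pi ^+ b * w) (pi ^+ c * z) = pi ^+ (p * a) * poly_h x w z.
Proof.
move=> e1; rewrite /poly_h !exprMn -!exprM.
have -> : pi ^+ (c * l) * z ^+ l * (pi ^+ (b * n) * w ^+ n) =
  pi ^+ (p * a) * (z ^+ l * w ^+ n).
  by rewrite e1 exprD (mulnC l) (mulnC n); ring.
by rewrite (mulnC a) mulrBr.
Qed.

(** The weights have product form because dilations and conditions on orders act on each coordinate
    separately. The innermost variable is z, the one in which h is solved. *)
Definition wmean M (f1 f2 f3 : K -> R) j : R :=
  mean M (fun x => f1 x * mean M (fun w => f2 w *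
    mean M (fun z => f3 z * in_ball j (poly_h x w z)))).

Lemma wmeanD1 M f f' f2 f3 j : wmean M (fun x => f x + f' x) f2 f3 j =
  wmean M f f2 f3 j + wmean M f' f2 f3 j.
Proof.
rewrite /wmean -meanD; apply: (eq_mean HK rs_size rs_transversal) => x _.
by rewrite mulrDl.
Qed.

Lemma wmeanD2 M f1 f f' f3 j : wmean M f1 (fun x => f x + f' x) f3 j =
  wmean M f1 f f3 j + wmean M f1 f' f3 j.
Proof.
rewrite /wmean -meanD; apply: (eq_mean HK rs_size rs_transversal) => x _.
rewrite -mulrDr -meanD; congr *%R.
by apply: (eq_mean HK rs_size rs_transversal) => w _; rewrite mulrDl.
Qed.

Lemma wmeanD3 M f1 f2 f f' j : wmean M f1 f2 (fun x => f x + f' x) j =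
  wmean M f1 f2 f j + wmean M f1 f2 f' j.
Proof.
rewrite /wmean -meanD; apply: (eq_mean HK rs_size rs_transversal) => x _.
rewrite -mulrDr -meanD; congr *%R.
apply: (eq_mean HK rs_size rs_transversal) => w _; rewrite -mulrDr -meanD; congr *%R.
by apply: (eq_mean HK rs_size rs_transversal) => z _; rewrite mulrDl.
Qed.

Lemma eq_wmean M f1 f2 f3 g1 g2 g3 j :
  (forall x, O x -> f1 x = g1 x) -> (forall x, O x -> f2 x = g2 x) ->
  (forall x, O x -> f3 x = g3 x) -> wmean M f1 f2 f3 j = wmean M g1 g2 g3 j.
Proof.
move=> h1 h2 h3; apply: (eq_mean HK rs_size rs_transversal) => x hx.
rewrite h1//; congr *%R; apply: (eq_mean HK rs_size rs_transversal) => w hw.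
rewrite h2//; congr *%R; apply: (eq_mean HK rs_size rs_transversal) => z hz.
by rewrite h3.
Qed.

Lemma wmean_eq0 M f1 f2 f3 j :
  (forall x w z, O x -> O w -> O z ->
    f1 x * (f2 w * (f3 z * in_ball j (poly_h x w z))) = 0) ->
  wmean M f1 f2 f3 j = 0.
Proof.
move=> h; rewrite /wmean.
transitivity (mean M (fun=> 0)); last exact: (mean_cst HK rs_size rs_transversal).
apply: (eq_mean HK rs_size rs_transversal) => x hx; rewrite -meanZ.
transitivity (mean M (fun=> 0)); last exact: (mean_cst HK rs_size rs_transversal).
apply: (eq_mean HK rs_size rs_transversal) => w hw; rewrite -!meanZ.
transitivity (mean M (fun=> 0)); last exact: (mean_cst HK rs_size rs_transversal).
by apply: (eq_mean HK rs_size rs_transversal) => z hz; exact: h.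
Qed.

Lemma wmean_sum1 M (I : Type) (s : seq I) (f : I -> K -> R) f2 f3 j :
  wmean M (fun x => \sum_(i <- s) f i x) f2 f3 j =
  \sum_(i <- s) wmean M (f i) f2 f3 j.
Proof.
elim: s => [|i s IH].
  by rewrite big_nil wmean_eq0// => x w z _ _ _; rewrite big_nil mul0r.
rewrite big_cons -IH -wmeanD1; apply: eq_wmean => // x _.
by rewrite big_cons.
Qed.

Lemma wmean_sum2 M (I : Type) (s : seq I) f1 (f : I -> K -> R) f3 j :
  wmean M f1 (fun x => \sum_(i <- s) f i x) f3 j =
  \sum_(i <- s) wmean M f1 (f i) f3 j.
Proof.
elim: s => [|i s IH].
  by rewrite big_nil wmean_eq0// => x w z _ _ _; rewrite big_nil mul0r mulr0.
rewrite big_cons -IH -wmeanD2; apply: eq_wmean => // x _.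
by rewrite big_cons.
Qed.

Lemma wmean_sum3 M (I : Type) (s : seq I) f1 f2 (f : I -> K -> R) j :
  wmean M f1 f2 (fun x => \sum_(i <- s) f i x) j =
  \sum_(i <- s) wmean M f1 f2 (f i) j.
Proof.
elim: s => [|i s IH].
  by rewrite big_nil wmean_eq0// => x w z _ _ _; rewrite big_nil mul0r !mulr0.
rewrite big_cons -IH -wmeanD3; apply: eq_wmean => // x _.
by rewrite big_cons.
Qed.

(** The factors [vl] cut out the image of the dilation with exponents (a,b,c). Substituting one
    coordinate at a time gives the Jacobian, and quasi-homogeneity multiplies h by pi^(p a), which
    lowers the index j by p a. *)
Lemma wmean_scale M a b c f1 f2 f3 j : mod_periodic M f1 -> mod_periodic M f2 ->
  mod_periodic M f3 -> (a <= M)%N -> (b <= M)%N -> (c <= M)%N -> (j + e <= M)%N ->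
  (p * a = l * c + n * b)%N ->
  wmean M (fun x => (vl a x)%:R * f1 x) (fun w => (vl b w)%:R * f2 w)
    (fun z => (vl c z)%:R * f3 z) j =
  (q%:R ^+ (a + b + c))^-1 *
  (if (p * a <= j)%N then wmean M (fun x => f1 (pi ^+ a * x))
     (fun w => f2 (pi ^+ b * w)) (fun z => f3 (pi ^+ c * z)) (j - p * a) else 0).
Proof.
move=> p1 p2 p3 aM bM cM jM e1.
have pb x w z x' w' z' : O x -> O w -> O z -> O x' -> O w' -> O z' ->
    vl M (x - x') -> vl M (w - w') -> vl M (z - z') ->
    in_ball j (poly_h x w z) = in_ball j (poly_h x' w' z').
  move=> *; congr (nat_of_bool _)%:R; apply: mem_vball_congr.
  by apply: (@vle_trans _ _ M); [rewrite lez_nat|apply: poly_h_congr].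
have v0 x : vl M (x - x) by rewrite subrr vle0.
have E3 := @eq_mean R _ _ _ _ _ HK _ rs_size rs_transversal.
have sc (d : nat) (f G : K -> R) : (d <= M)%N -> mod_periodic M f -> mod_periodic M G ->
    mean M (fun x => (vl d x)%:R * f x * G x) =
    (q%:R ^+ d)^-1 * mean M (fun x => f (pi ^+ d * x) * G (pi ^+ d * x)).
  move=> dM pf pG; rewrite -(mean_scale HK rs_size rs_transversal (F := fun x => f x * G x))//.
    by apply: (E3) => x _; rewrite mulrA.
  by move=> x y hx hy h; rewrite (pf x y)// (pG x y).
(* [I] and [J] are the inner averages after substitution in z, then in z and w. Each must be known
   to be periodic before the next variable is scaled. *)
pose I x w := mean M (fun z => f3 (pi ^+ c * z) * in_ball j (poly_h x w (pi ^+ c * z))).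
pose J x := mean M (fun w => f2 (pi ^+ b * w) * I x (pi ^+ b * w)).
have Ip x w x' w' : O x -> O w -> O x' -> O w' -> vl M (x - x') -> vl M (w - w') ->
    I x w = I x' w'.
  move=> *; apply: (E3) => z hz; congr *%R.
  by apply: pb; rewrite ?(OM HK) ?(Opi HK).
have E1 x w : O x -> O w ->
    mean M (fun z => (vl c z)%:R * f3 z * in_ball j (poly_h x w z)) =
    (q%:R ^+ c)^-1 * I x w.
  by move=> hx hw; rewrite sc// => z z' hz hz' h; apply: pb.
have E2 x : O x -> mean M (fun w => (vl b w)%:R * f2 w *
    mean M (fun z => (vl c z)%:R * f3 z * in_ball j (poly_h x w z))) =
    (q%:R ^+ c)^-1 * (q%:R ^+ b)^-1 * J x.
  move=> hx; transitivity
    (mean M (fun w => (q%:R ^+ c)^-1 * ((vl b w)%:R * f2 w * I x w))).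
    by apply: (E3) => w hw; rewrite E1// mulrCA.
  by rewrite meanZ sc ?mulrA// => w w' hw hw' h; apply: Ip.
have -> : wmean M (fun x => (vl a x)%:R * f1 x) (fun w => (vl b w)%:R * f2 w)
    (fun z => (vl c z)%:R * f3 z) j = (q%:R ^+ (a + b + c))^-1 *
  mean M (fun x => f1 (pi ^+ a * x) * J (pi ^+ a * x)).
  transitivity (mean M (fun x => (q%:R ^+ c)^-1 * (q%:R ^+ b)^-1 *
     ((vl a x)%:R * f1 x * J x))).
    by apply: (E3) => x hx; rewrite E2// mulrCA.
  rewrite meanZ sc//; last first.
    by move=> x x' hx hx' h; apply: (E3) => w hw; congr *%R; apply: Ip;
      rewrite ?(OM HK) ?(Opi HK).
  by rewrite !exprD !invfM !mulrA; congr (_ * _); ring.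
congr *%R; case: ifP => pj.
  apply: (E3) => x hx; congr *%R; apply: (E3) => w hw; congr *%R.
  apply: (E3) => z hz; congr *%R; rewrite poly_h_scale// /in_ball.
  by rewrite -{1}(subnKC pj) mem_vball_pi.
(* For j < p a the dilated value of h lies in pi^(p a) O and cannot have order j. *)
transitivity (mean M (fun=> 0)); last exact: (mean_cst HK rs_size rs_transversal).
apply: (E3) => x hx; rewrite -meanZ.
transitivity (mean M (fun=> 0)); last exact: (mean_cst HK rs_size rs_transversal).
apply: (E3) => w hw; rewrite -!meanZ.
transitivity (mean M (fun=> 0)); last exact: (mean_cst HK rs_size rs_transversal).
apply: (E3) => z hz; rewrite poly_h_scale// /in_ball (@mem_vball0 (p * a)).
- by rewrite !mulr0.
- by rewrite -[(p * a)%:Z]addr0 (vle_piX HK); exact: poly_h_O.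
- by rewrite ltnNge pj.
Qed.

(* [phi y = ((1 + pi y)^l - 1) / pi] is an isometry of O since its difference
   quotients reduce to [l], a unit. *)
Lemma mean_one_unit M j (g : nat) (A G : K) : O A -> G != 0 -> ord G = g -> (g < j)%N ->
  (j + e <= M)%N ->
  mean M (fun y => in_ball j (A - G * (1 + pi * y) ^+ l)) =
  (vl g.+1 (A - G))%:R * (q%:R ^+ (j + e - g.+1))^-1.
Proof.
move=> OA G0 oG gj jM.
have OG : O G by rewrite /in_OK vle_nz// oG.
have O1y y : O y -> O (1 + pi * y).
  move=> hy; apply: (vleD HK); first exact: (O1 HK).
  by apply: (OM HK) => //; exact: (Opi HK 1).
pose phi y : K := y * \sum_(i < l) (1 + pi * y) ^+ i.
have phiE y : (1 + pi * y) ^+ l = 1 + pi * phi y.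
  rewrite -[LHS](subrK 1) subrX1 /phi; set S := (\sum_(i < l) _); ring.
have Osum (F : 'I_l -> K) : (forall i, O (F i)) -> O (\sum_i F i).
  move=> h; elim/big_ind: _ => [|a b ha hb|i _//]; [exact: vle0|exact: (vleD HK)].
have phiO y : O y -> O (phi y).
  by move=> hy; apply: (OM HK) => //; apply: Osum => i; apply/(OX HK)/O1y.
have phi_iso y y' : O y -> O y' -> vl M (phi y - phi y') -> vl M (y - y').
  move=> hy hy'.
  pose S := \sum_(i < l) (1 + pi * y) ^+ (l.-1 - i) * (1 + pi * y') ^+ i.
  have -> : phi y - phi y' = S * (y - y').
    apply: (mulfI (pi0 HK)).
    have -> : pi * (phi y - phi y') = (1 + pi * y) ^+ l - (1 + pi * y') ^+ l.
      by rewrite !phiE; ring.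
    by rewrite subrXX -/S; ring.
  have /andP[l0 /eqP ol] := l_unit.
  have c1 i y1 : O y1 -> vl 1 ((1 + pi * y1) ^+ i - 1).
    move=> h1; rewrite -[X in _ - X](expr1n K i).
    apply: (vle_subX HK); [exact: O1y|exact: (O1 HK)|].
    by rewrite addrC addKr -[1%:Z]addr0 -[X in X * _]expr1 (vle_piX HK).
  have [S0 oS] : S != 0 /\ ord S = 0.
    rewrite -ol; apply: (ord_congr HK) => //; rewrite ol add0r.
    have -> : l%:R = \sum_(i < l) 1 :> K by rewrite sumr_const card_ord.
    rewrite -sumrB; elim/big_ind: _ => [|a b ha hb|i _]; [exact: vle0|exact: (vleD HK)|].
    rewrite -[X in _ - X]mulr1; apply: (vle_subM HK).
    - exact/(OX HK)/O1y.
    - exact: (O1 HK).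
    - exact: c1.
    - exact: c1.
  by rewrite -[X in vle _ X _ -> _]add0r -oS (vle_scale HK).
pose H y := in_ball j (A - G - G * pi * y).
have -> : mean M (fun y => in_ball j (A - G * (1 + pi * y) ^+ l)) =
          mean M (fun y => H (phi y)).
  apply: (eq_mean HK rs_size rs_transversal) => y hy; rewrite /H phiE.
  by congr (in_ball j _); ring.
have Gp0 : G * pi != 0 by rewrite mulf_neq0 ?(pi0 HK).
have oGp : ord (G * pi) = g.+1 by rewrite (ordM HK) ?(pi0 HK)// oG (ord_pi HK); lia.
rewrite (mean_map HK rs_size rs_transversal) //; last first.
  move=> y y' hy hy' h; congr (nat_of_bool _)%:R; apply: mem_vball_congr.
  have -> : A - G - G * pi * y - (A - G - G * pi * y') = - (G * pi * (y - y')) by ring.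
  rewrite (vleN HK); apply: (@vle_trans _ _ M); first by rewrite lez_nat.
  by apply: (vleMl HK) => //; rewrite /in_OK vle_nz// oGp.
(* Since g < j, membership in the ball forces A - G into pi^(g+1) O; otherwise the average is
   zero. *)
rewrite /H; case: (boolP (vl g.+1 (A - G))) => hA; last first.
  rewrite mul0r; transitivity (mean M (fun=> 0)); last first.
    exact: (mean_cst HK rs_size rs_transversal).
  apply: (eq_mean HK rs_size rs_transversal) => y hy.
  apply: in_ball_eq0; apply/negP => /mem_vball_ord[h0 oh].
  move/negP: hA; apply.
  have -> : A - G = (A - G - G * pi * y) + G * pi * y by ring.
  apply: (vleD HK); first by rewrite vle_nz// oh lez_nat.
  by rewrite -[g.+1%:Z]addr0 -oGp (vle_scale HK).
(* With [phi] removed the condition is affine in y: it places y in the ball with centre c and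
   exponent j + e - (g + 1), as G pi has order g + 1. *)
pose c := (A - G - pi ^+ j * r) / (G * pi).
have cE : G * pi * c = A - G - pi ^+ j * r by rewrite mulrC divfK.
have Oc : O c.
  rewrite /in_OK -(@vle_scale _ _ _ _ _ HK (G * pi))// cE oGp addr0.
  apply: (vleB HK) => //; apply: (@vle_trans _ _ (j%:Z + 0)).
    by rewrite addr0 lez_nat.
  by rewrite (vle_piX HK).
rewrite mul1r -(mean_ball R HK rs_size rs_transversal Oc (M := M)); last first.
  exact: leq_trans (leq_subr _ _) jM.
apply: (eq_mean HK rs_size rs_transversal) => y hy.
congr (nat_of_bool _)%:R; rewrite /mem_vball.
have -> : A - G - G * pi * y - pi ^+ j * r = G * pi * (c - y).
  by rewrite mulrBr cE; ring.
have -> : (j + e)%N%:Z = ord (G * pi) + (j + e - g.+1)%N%:Z.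
  by rewrite oGp -PoszD subnKC// (leq_trans gj)// leq_addr.
by rewrite (vle_scale HK)// (vle_distC HK).
Qed.

Definition ge_ord (b : nat) (x : K) : R := (vl b x)%:R.
(** The difference form telescopes, and it vanishes at 0, which lies in every [ge_ord b]. *)
Definition shell (b : nat) (x : K) : R := ge_ord b x - ge_ord b.+1 x.

Lemma shellE b x : shell b x = ((x != 0) && (ord x == b))%:R.
Proof.
rewrite /shell /ge_ord /vle; have [_|x0] := eqVneq x 0; first by rewrite subrr.
rewrite /=; case: (ltgtP (ord x) b%:Z) => h.
- have -> : (b.+1%:Z <= ord x) = false by lia.
  by rewrite subr0.
- have -> : (b.+1%:Z <= ord x) = true by lia.
  by rewrite subrr.
- have -> : (b.+1%:Z <= ord x) = false by lia.
  by rewrite subr0.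
Qed.

Lemma ge_ord_periodic b M : (b <= M)%N -> mod_periodic M (ge_ord b).
Proof.
move=> bM x y _ _ h; congr (nat_of_bool _)%:R; apply: (vle_congr HK).
by apply: vle_trans h; rewrite lez_nat.
Qed.

Lemma shell_periodic b M : (b < M)%N -> mod_periodic M (shell b).
Proof.
by move=> bM x y hx hy h; congr (_ - _); apply: (@ge_ord_periodic _ M) => //; exact: ltnW.
Qed.

Lemma ge_ord_shells a b x : (a <= b)%N ->
  ge_ord a x = ge_ord b x + \sum_(a <= i < b) shell i x.
Proof.
move=> ab; rewrite (eq_bigr (fun i => - (ge_ord i.+1 x - ge_ord i x))); last first.
  by move=> i _; rewrite opprB.
rewrite sumrN (telescope_sumr (fun i => ge_ord i x))//; ring.
Qed.

(** Averaging over the multiplicative translates z (1 + pi y) makes z a parameter and leaves a mean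
    over y. There [mean_one_unit] applies with G = z^l w^n, of order l b + n c; its value depends on
    the index only through a power of q, so one more step in j costs exactly 1/q. *)
Lemma mean_shell_rec M (b c : nat) x w j : O x -> O w -> w != 0 -> ord w = c ->
  (l * b + n * c < j)%N -> (j.+1 + e <= M)%N -> (b < M)%N ->
  mean M (fun z => shell b z * in_ball j.+1 (poly_h x w z)) =
  q%:R^-1 * mean M (fun z => shell b z * in_ball j (poly_h x w z)).
Proof.
move=> Ox Ow w0 ow gj jM bM.
have E := @eq_mean R _ _ _ _ _ HK _ rs_size rs_transversal.
have key i : (j <= i)%N -> (i + e <= M)%N ->
   mean M (fun z => shell b z * in_ball i (poly_h x w z)) =
   mean M (fun z => shell b z * (vl (l * b + n * c).+1 (x ^+ p - z ^+ l * w ^+ n))%:R)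
     * (q%:R ^+ (i + e - (l * b + n * c).+1))^-1.
  move=> ji iM.
  set F := fun z => shell b z * in_ball i (poly_h x w z).
  have pF : mod_periodic M F.
    move=> z z' hz hz' h; rewrite /F (shell_periodic bM hz hz' h); congr *%R.
    congr (nat_of_bool _)%:R; apply: mem_vball_congr.
    by apply: (@vle_trans _ _ M); [rewrite lez_nat|apply: poly_h_congr; rewrite ?subrr ?vle0].
  have unit1 y : O y -> 1 + pi * y != 0 /\ ord (1 + pi * y) = 0.
    move=> hy; rewrite -(ord_one HK); apply: (ord_congr HK); first exact: oner_neq0.
    by rewrite (ord_one HK) add0r addrC addKr -[1]addr0 -[X in X * _]expr1 (vle_piX HK).
  have avg y : O y -> mean M F = mean M (fun z => F (z * (1 + pi * y))).
    move=> hy; have [u0 ou] := unit1 y hy.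
    rewrite (mean_map HK rs_size rs_transversal pF)// => [z hz|z z' hz hz'].
      by apply: (OM HK) => //; rewrite /in_OK vle_nz// ou.
    by rewrite -mulrBl mulrC -[X in vle _ X _ -> _]add0r -ou (vle_scale HK).
  (* The constant is written as a mean over y, so that the means over y and z can be exchanged. *)
  rewrite -(mean_cst HK rs_size rs_transversal M (mean M F)) (E M _ _ avg).
  rewrite mean_exchange [RHS]mulrC -meanZ; apply: (E) => z hz.
  have sh y : O y -> shell b (z * (1 + pi * y)) = shell b z.
    move=> hy; have [u0 ou] := unit1 y hy; rewrite !shellE.
    have [->|z0] := eqVneq z 0; first by rewrite mul0r eqxx.
    by rewrite mulf_neq0// (ordM HK)// ou addr0.
  under E => y hy do rewrite /F sh// /poly_h exprMn mulrAC.
  rewrite meanZ shellE.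
  case: (boolP ((z != 0) && (ord z == b))) => [/andP[z0 /eqP oz]|_]; last first.
    by rewrite !mul0r mulr0.
  rewrite !mul1r [RHS]mulrC; apply: mean_one_unit; rewrite ?mulf_neq0 ?expf_neq0//.
  - exact: (OX HK).
  - rewrite (ordM HK) ?expf_neq0// !(ordX HK)// oz ow.
    by rewrite -[b%:Z *+ l]mulr_natr -[c%:Z *+ n]mulr_natr !natz -!PoszM -PoszD (mulnC l) (mulnC n).
  - exact: leq_trans gj ji.
rewrite (key j.+1 (leqnSn j) jM) (key j (leqnn j)); last first.
  by rewrite (leq_trans _ jM)// leq_add2r.
rewrite addSn subSn; last by rewrite (leq_trans gj)// leq_addr.
by rewrite exprS invfM mulrCA.
Qed.

Lemma wmean_shell_rec M f1 (b c : nat) j :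
  (l * b + n * c < j)%N -> (j.+1 + e <= M)%N -> (b < M)%N ->
  wmean M f1 (shell c) (shell b) j.+1 = q%:R^-1 * wmean M f1 (shell c) (shell b) j.
Proof.
move=> h1 h2 h3; rewrite /wmean -meanZ.
apply: (eq_mean HK rs_size rs_transversal) => x hx; rewrite [RHS]mulrCA; congr *%R; rewrite -meanZ.
apply: (eq_mean HK rs_size rs_transversal) => w hw.
rewrite shellE; case: (boolP ((w != 0) && (ord w == c))) => [/andP[w0 /eqP ow]|_].
  by rewrite !mul1r (mean_shell_rec (c := c)).
by rewrite !mul0r mulr0.
Qed.

(** Here z^l w^n has order greater than p i = ord (x^p), so h has order exactly p i and misses every
    ball of order j > p i. *)
Lemma wmean_shell1_eq0 M i b c j : (p * i < l * c + n * b)%N -> (p * i < j)%N ->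
  wmean M (shell i) (ge_ord b) (ge_ord c) j = 0.
Proof.
move=> h1 h2; apply: wmean_eq0 => x w z hx hw hz.
rewrite shellE; case: (boolP ((x != 0) && (ord x == i))) => [/andP[x0 /eqP ox]|_]; last first.
  by rewrite mul0r.
rewrite /ge_ord; case: (boolP (vl b w)) => hb; last by rewrite mul0r mulr0.
case: (boolP (vl c z)) => hc; last by rewrite mul0r !mulr0.
rewrite !mul1r; apply: in_ball_eq0; apply/negP => /mem_vball_ord[_ oh].
have xp0 : x ^+ p != 0 by rewrite expf_neq0.
have op : ord (x ^+ p) = (p * i)%N by rewrite (ordX HK)// ox -mulr_natr natz -PoszM mulnC.
have [] := ord_congr HK xp0 (y := poly_h x w z); last first.
  by rewrite oh op => _ [ej]; rewrite ej ltnn in h2.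
have -> : poly_h x w z - x ^+ p = - (z ^+ l * w ^+ n) by rewrite /poly_h; ring.
rewrite (vleN HK) op.
have [y1 O1 ->] := vle_div HK hb; have [y2 O2 ->] := vle_div HK hc.
rewrite !exprMn -!exprM.
have -> : pi ^+ (c * l) * y2 ^+ l * (pi ^+ (b * n) * y1 ^+ n) =
   pi ^+ (l * c + n * b) * (y2 ^+ l * y1 ^+ n).
  by rewrite exprD (mulnC l) (mulnC n); ring.
apply: (@vle_trans _ _ ((l * c + n * b)%N%:Z + 0)).
  by move: h1; rewrite addr0 -lez_nat -addn1 PoszD.
by rewrite (vle_piX HK); apply: (OM HK); exact: (OX HK).
Qed.

End Weighted.

(** * Linear recurrences *)

Section PolyVanish.
Variable R : nzRingType.

(** A series truncated at N says nothing from index N on, hence the window. In the applications J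
    stays fixed while N grows. *)
Definition vanish (J N : nat) (P : {poly R}) :=
  forall i, (J <= i)%N -> (i < N)%N -> P`_i = 0.

Lemma vanish_le J J' N P : (J <= J')%N -> vanish J N P -> vanish J' N P.
Proof. by move=> JJ h i Ji; apply: h; exact: leq_trans Ji. Qed.

Lemma vanishD J J' N P Q : vanish J N P -> vanish J' N Q ->
  vanish (maxn J J') N (P + Q).
Proof.
by move=> h h' i; rewrite geq_max => /andP[h1 h2] iN; rewrite coefD h// h'// addr0.
Qed.

(** Coefficient i of the product reads only coefficients of [P] from i - size Q + 1 up to i, all
    inside the window. *)
Lemma vanishM J N (P Q : {poly R}) : vanish J N P -> vanish (J + size Q) N (Q * P).
Proof.
move=> h i Ji iN; rewrite coefM big1// => j _.
have [jQ|jQ] := ltnP j (size Q); last by rewrite (nth_default _ jQ) mul0r.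
rewrite h ?mulr0//; last by rewrite (leq_ltn_trans _ iN)// leq_subr.
lia.
Qed.

Definition euler_factor (a : R) (d : nat) : {poly R} := 1 - a *: 'X^d.

Lemma coef_euler_factorM a d P i :
  (euler_factor a d * P)`_i = P`_i - (if (d <= i)%N then a * P`_(i - d) else 0).
Proof.
rewrite /euler_factor mulrBl mul1r coefB -scalerAl coefZ coefXnM.
by rewrite ltnNge; case: (d <= i)%N => //=; rewrite mulr0.
Qed.

End PolyVanish.

(** * Recurrences for the volumes of level sets *)

Section Recurrence.
Variables (R : realType) (K : fieldType) (p q : nat) (ord : K -> int) (pi : K).
Hypothesis HK : nonarch_local_field p q ord pi.
Variable rs : seq K.
Hypothesis rs_size : size rs = q.
Hypothesis rs_transversal : mod_transversal ord (in_OK ord) 1 rs.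
Variables (l n m e : nat) (r : K).
Hypothesis l_unit : is_unitK ord (l%:R : K).
Hypothesis n_gt0 : (0 < n)%N.
Hypothesis pmE : (p * m = l + n)%N.
Hypothesis e_gt0 : (0 < e)%N.
Hypothesis r_unit : is_unitK ord r.

Local Notation vl n x := (vle ord (n : nat)%:Z x).
Local Notation O x := (in_OK ord x).
Local Notation W f1 f2 f3 := (fun M j => @wmean R K p q ord pi rs l n e r M f1 f2 f3 j).
Local Notation shell := (@shell R K ord).
Local Notation ge_ord := (@ge_ord R K ord).

Let l_gt0 : (0 < l)%N.
Proof. by move: l_unit; rewrite /is_unitK; case: (l) => //; rewrite eqxx. Qed.

(** Eventually geometric in j of ratio 1/q. [S M j] stands for a volume computed modulo pi^M, which
    is reliable only when M exceeds j by a margin c; neither J nor c may depend on M. *)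
Definition tame (S : nat -> nat -> R) := exists J c, forall M j,
  (J <= j)%N -> (j + c <= M)%N -> S M j.+1 = q%:R^-1 * S M j.

Lemma tame_ext S S' : (forall M j, S M j = S' M j) -> tame S -> tame S'.
Proof. by move=> E [J [c h]]; exists J, c => M j Jj jM; rewrite -!E h. Qed.

Lemma tame_lin a S b S' : tame S -> tame S' -> tame (fun M j => a * S M j + b * S' M j).
Proof.
move=> [J [c h]] [J' [c' h']]; exists (J + J')%N, (c + c')%N => M j Jj jM.
by rewrite h ?h'; [ring|lia..].
Qed.

Lemma tameD S S' : tame S -> tame S' -> tame (fun M j => S M j + S' M j).
Proof.
move=> h h'; apply: tame_ext (tame_lin 1 1 h h') => M j.
by rewrite !mul1r.
Qed.

Lemma tameB S S' : tame S -> tame S' -> tame (fun M j => S M j - S' M j).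
Proof.
move=> h h'; apply: tame_ext (tame_lin 1 (-1) h h') => M j.
by rewrite mul1r mulN1r.
Qed.

Lemma tame_eq0 S J : (forall M j, (J <= j)%N -> S M j = 0) -> tame S.
Proof. by move=> h; exists J, 0%N => M j Jj _; rewrite !h ?mulr0//; lia. Qed.

Lemma tame_sum (s : seq nat) (S : nat -> nat -> nat -> R) : (forall i, tame (S i)) ->
  tame (fun M j => \sum_(i <- s) S i M j).
Proof.
move=> h; elim: s => [|i s IH].
  by apply: (@tame_eq0 _ 0) => M j _; rewrite big_nil.
by apply: tame_ext (tameD (h i) IH) => M j; rewrite big_cons.
Qed.

Lemma tame_shell23 f1 b c : tame (W f1 (shell c) (shell b)).
Proof.
exists (l * b + n * c).+1, (e + b).+1 => M j h1 h2.
by apply: (wmean_shell_rec HK rs_size rs_transversal l_unit) => //; lia.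
Qed.

Lemma split1 f2 f3 a b M j : (a <= b)%N -> W (ge_ord a) f2 f3 M j =
  W (ge_ord b) f2 f3 M j + \sum_(a <= i < b) W (shell i) f2 f3 M j.
Proof.
move=> ab; rewrite -(wmean_sum1 HK rs_size rs_transversal) -(wmeanD1 HK rs_size rs_transversal).
by apply: (eq_wmean HK rs_size rs_transversal) => // x _; exact: ge_ord_shells.
Qed.

Lemma split2 f1 f3 a b M j : (a <= b)%N -> W f1 (ge_ord a) f3 M j =
  W f1 (ge_ord b) f3 M j + \sum_(a <= i < b) W f1 (shell i) f3 M j.
Proof.
move=> ab; rewrite -(wmean_sum2 HK rs_size rs_transversal) -(wmeanD2 HK rs_size rs_transversal).
by apply: (eq_wmean HK rs_size rs_transversal) => // x _; exact: ge_ord_shells.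
Qed.

Lemma split3 f1 f2 a b M j : (a <= b)%N -> W f1 f2 (ge_ord a) M j =
  W f1 f2 (ge_ord b) M j + \sum_(a <= i < b) W f1 f2 (shell i) M j.
Proof.
move=> ab; rewrite -(wmean_sum3 HK rs_size rs_transversal) -(wmeanD3 HK rs_size rs_transversal).
by apply: (eq_wmean HK rs_size rs_transversal) => // x _; exact: ge_ord_shells.
Qed.

Lemma shell3E f1 f2 c M j : W f1 f2 (shell c) M j =
  W f1 f2 (ge_ord c) M j - W f1 f2 (ge_ord c.+1) M j.
Proof. by rewrite /= (@split3 _ _ c c.+1)// big_nat1 addrAC subrr add0r. Qed.

Lemma shell2E f1 f3 c M j : W f1 (shell c) f3 M j =
  W f1 (ge_ord c) f3 M j - W f1 (ge_ord c.+1) f3 M j.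
Proof. by rewrite /= (@split2 _ _ c c.+1)// big_nat1 addrAC subrr add0r. Qed.

(** With ord x = i, the term x^p dominates as soon as ord w or ord z is large, and such pieces
    vanish for large j. What remains is a finite sum over pairs of shells in w and z, to which
    [tame_shell23] applies. *)
Lemma tame_shell1 i b c : tame (W (shell i) (ge_ord b) (ge_ord c)).
Proof.
have z b' c' : (p * i < l * c' + n * b')%N -> tame (W (shell i) (ge_ord b') (ge_ord c')).
  move=> h; apply: (@tame_eq0 _ (p * i).+1) => M j hj.
  exact: (wmean_shell1_eq0 R HK rs_size rs_transversal).
(* Any bound above p i is large enough, because l and n are positive. *)
pose B := (b + (p * i).+1)%N; pose C := (c + (p * i).+1)%N.
have hB c' : (p * i < l * c' + n * B)%N.
  apply: (@leq_trans (n * B)); last exact: leq_addl.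
  by apply: (@leq_trans B); [exact: leq_addl|exact: leq_pmull].
have hC b' : (p * i < l * C + n * b')%N.
  apply: (@leq_trans (l * C)); last exact: leq_addr.
  by apply: (@leq_trans C); [exact: leq_addl|exact: leq_pmull].
apply: (@tame_ext (fun M j => W (shell i) (ge_ord b) (ge_ord C) M j +
   \sum_(c <= c' < C) (W (shell i) (ge_ord B) (shell c') M j +
      \sum_(b <= b' < B) W (shell i) (shell b') (shell c') M j))).
  move=> M j /=; rewrite (@split3 _ _ c C) ?leq_addr//; congr (_ + _).
  by apply: eq_bigr => c' _; rewrite (@split2 _ _ b B) ?leq_addr.
apply: tameD; first exact: z.
apply: tame_sum => c'; apply: tameD; last by apply: tame_sum => b'; exact: tame_shell23.
apply: (@tame_ext _ _ (fun M j => esym (shell3E _ _ _ M j))).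
by apply: tameB; exact: z.
Qed.

Lemma ge_ord_pi a b x : ge_ord (a + b) (pi ^+ a * x) = ge_ord b x.
Proof. by rewrite /ge_ord PoszD (vle_piX HK). Qed.

Lemma ge_ordM a b x : (a <= b)%N -> (vl a x)%:R * ge_ord b x = ge_ord b x.
Proof.
move=> ab; rewrite /ge_ord; case: (boolP (vl b x)) => h; last by rewrite mulr0.
by rewrite (vle_trans _ h) ?mulr1.
Qed.

Lemma ge_ord0 x : O x -> ge_ord 0 x = 1.
Proof. by rewrite /ge_ord /in_OK => ->. Qed.

Definition density : nat -> nat -> R := W (ge_ord 0) (ge_ord 0) (ge_ord 0).
(** The next three definitions partition the complement of the image of the dilation (m,1,1): first
    ord x < m, then ord x >= m with z a unit, then ord x >= m with w a unit and z not a unit. *)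
Definition part_x : nat -> nat -> R :=
  fun M j => \sum_(0 <= i < m) W (shell i) (ge_ord 0) (ge_ord 0) M j.
Definition part_z : nat -> nat -> R := W (ge_ord m) (ge_ord 0) (shell 0).
Definition part_w : nat -> nat -> R := W (ge_ord m) (shell 0) (ge_ord 1).

Lemma density_rec M j : (j + (e + m + 1) <= M)%N ->
  density M j = (part_x M j + part_z M j + part_w M j) +
   (if (p * m <= j)%N then (q%:R ^+ (m + 2))^-1 * density M (j - p * m) else 0).
Proof.
move=> jM.
rewrite {1}/density (@split1 _ _ 0 m)// (@split3 _ _ 0 1)// big_nat1.
rewrite (@split2 _ _ 0 1)// big_nat1.
transitivity ((part_x M j + part_z M j + part_w M j) + W (ge_ord m) (ge_ord 1) (ge_ord 1) M j).
  by rewrite /part_x /part_z /part_w; ring.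
congr (_ + _).
(* An indicator is idempotent; the extra factor is the cut-off that [wmean_scale] expects. *)
have -> : W (ge_ord m) (ge_ord 1) (ge_ord 1) M j =
    W (fun x => (vl m x)%:R * ge_ord m x) (fun x => (vl 1 x)%:R * ge_ord 1 x)
      (fun x => (vl 1 x)%:R * ge_ord 1 x) M j.
  by apply: (eq_wmean HK rs_size rs_transversal) => x _; rewrite ge_ordM.
rewrite /= (wmean_scale HK rs_size rs_transversal e_gt0 r_unit);
  try apply: (ge_ord_periodic _ HK); try lia.
rewrite -addnA; case: ifP => _; last by rewrite mulr0.
congr *%R; apply: (eq_wmean HK rs_size rs_transversal) => x _.
- by rewrite -(ge_ord_pi m 0 x) addn0.
- by rewrite -(ge_ord_pi 1 0 x) addn0.
- by rewrite -(ge_ord_pi 1 0 x) addn0.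
Qed.

(** The dilation (n,p,0) maps this piece onto ord x >= m + n, ord w >= p with z a unit. The
    complement consists of finitely many shells in x, and of finitely many shells in w with z a
    unit; all of them are tame. *)
Lemma part_z_rec : exists2 S, tame S & exists c, forall M j, (j + c <= M)%N ->
  part_z M j = S M j +
   (if (n * p <= j)%N then (q%:R ^+ (p + n))^-1 * part_z M (j - n * p) else 0).
Proof.
exists (fun M j => \sum_(m <= i < m + n) W (shell i) (ge_ord 0) (shell 0) M j +
    \sum_(0 <= c < p) W (ge_ord (m + n)) (shell c) (shell 0) M j).
  apply: tameD; last by apply: tame_sum => c; exact: tame_shell23.
  apply: tame_sum => i; apply: (@tame_ext _ _ (fun M j => esym (shell3E _ _ _ M j))).
  by apply: tameB; exact: tame_shell1.
exists (e + m + n + p + 1)%N => M j jM.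
rewrite {1}/part_z (@split1 _ _ m (m + n)) ?leq_addr// (@split2 _ _ 0 p)//.
transitivity ((\sum_(m <= i < m + n) W (shell i) (ge_ord 0) (shell 0) M j +
    \sum_(0 <= c < p) W (ge_ord (m + n)) (shell c) (shell 0) M j) +
    W (ge_ord (m + n)) (ge_ord p) (shell 0) M j); first by ring.
congr (_ + _).
have -> : W (ge_ord (m + n)) (ge_ord p) (shell 0) M j =
    W (fun x => (vl n x)%:R * ge_ord (m + n) x) (fun x => (vl p x)%:R * ge_ord p x)
      (fun x => (vl 0 x)%:R * shell 0 x) M j.
  apply: (eq_wmean HK rs_size rs_transversal) => x hx; rewrite ?ge_ordM ?leq_addl//.
  by rewrite [vl _ _]hx mul1r.
rewrite /= (wmean_scale HK rs_size rs_transversal e_gt0 r_unit) ?muln0 ?(mulnC p)//;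
  try apply: (ge_ord_periodic _ HK); try apply: (shell_periodic _ HK); try lia.
rewrite addn0 (addnC n p); case: ifP => _; last by rewrite mulr0.
congr *%R; apply: (eq_wmean HK rs_size rs_transversal) => x _.
- by rewrite addnC ge_ord_pi.
- by rewrite -(ge_ord_pi p 0 x) addn0.
- by rewrite mul1r.
Qed.

(** As for [part_z_rec], with the dilation (l,0,p) acting on x and z. Here z starts at order 1, so
    its image starts at order p + 1. *)
Lemma part_w_rec : exists2 S, tame S & exists c, forall M j, (j + c <= M)%N ->
  part_w M j = S M j +
   (if (p * l <= j)%N then (q%:R ^+ (p + l))^-1 * part_w M (j - p * l) else 0).
Proof.
exists (fun M j => \sum_(m <= i < m + l) W (shell i) (shell 0) (ge_ord 1) M j +
    \sum_(1 <= c < p + 1) W (ge_ord (m + l)) (shell 0) (shell c) M j).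
  apply: tameD; last by apply: tame_sum => c; exact: tame_shell23.
  apply: tame_sum => i; apply: (@tame_ext _ _ (fun M j => esym (shell2E _ _ _ M j))).
  by apply: tameB; exact: tame_shell1.
exists (e + m + l + p + 2)%N => M j jM.
rewrite {1}/part_w (@split1 _ _ m (m + l)) ?leq_addr// (@split3 _ _ 1 (p + 1)) ?leq_addl//.
transitivity ((\sum_(m <= i < m + l) W (shell i) (shell 0) (ge_ord 1) M j +
    \sum_(1 <= c < p + 1) W (ge_ord (m + l)) (shell 0) (shell c) M j) +
    W (ge_ord (m + l)) (shell 0) (ge_ord (p + 1)) M j); first by ring.
congr (_ + _).
have -> : W (ge_ord (m + l)) (shell 0) (ge_ord (p + 1)) M j =
    W (fun x => (vl l x)%:R * ge_ord (m + l) x) (fun x => (vl 0 x)%:R * shell 0 x)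
      (fun x => (vl p x)%:R * ge_ord (p + 1) x) M j.
  apply: (eq_wmean HK rs_size rs_transversal) => x hx; rewrite ?ge_ordM ?leq_addl ?leq_addr//.
  by rewrite [vl _ _]hx mul1r.
rewrite /= (wmean_scale HK rs_size rs_transversal e_gt0 r_unit) ?muln0 ?addn0 ?(mulnC p)//;
  try apply: (ge_ord_periodic _ HK); try apply: (shell_periodic _ HK); try lia.
rewrite (addnC l p); case: ifP => _; last by rewrite mulr0.
congr *%R; apply: (eq_wmean HK rs_size rs_transversal) => x _.
- by rewrite addnC ge_ord_pi.
- by rewrite mul1r.
- by rewrite ge_ord_pi.
Qed.

Lemma tame_part_x : tame part_x.
Proof. by apply: tame_sum => i; exact: tame_shell1. Qed.

Definition gen (S : nat -> nat -> R) (M N : nat) : {poly R} := \poly_(j < N) S M j.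

Lemma tame_vanish S : tame S -> exists J c, forall N M, (N + c <= M)%N ->
  vanish J N (euler_factor q%:R^-1 1 * gen S M N).
Proof.
(* Coefficient i of the product compares the indices i and i - 1, so the onset moves up by one. *)
move=> [J [c h]]; exists J.+1, c => N M NM [//|i] Ji iN.
rewrite coef_euler_factorM !coef_poly iN subn1/= (ltn_trans _ iN)//.
by rewrite h ?subrr//; lia.
Qed.

(** Truncating at N is harmless: the recurrence at j reads only j and j - d. *)
Lemma rec_vanish (S S' : nat -> nat -> R) (a : R) (d N M : nat) :
  (forall j, (j < N)%N -> S M j = S' M j + (if (d <= j)%N then a * S M (j - d)%N else 0)) ->
  vanish 0 N (euler_factor a d * gen S M N - gen S' M N).
Proof.
move=> h i _ iN; rewrite coefB coef_euler_factorM !coef_poly iN.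
rewrite (leq_ltn_trans (leq_subr d i) iN) h//.
by rewrite addrK subrr.
Qed.

Definition denominator : {poly R} :=
  euler_factor q%:R^-1 1 * euler_factor (q%:R ^+ (m + 2))^-1 (p * m) *
  euler_factor (q%:R ^+ (p + n))^-1 (n * p) * euler_factor (q%:R ^+ (p + l))^-1 (p * l).

Lemma density_vanish : exists J c, forall N M, (N + c <= M)%N ->
  vanish J N (denominator * gen density M N).
Proof.
have [Sz tz [cz hz]] := part_z_rec; have [Sw tw [cw hw]] := part_w_rec.
have [Jx [cx vx]] := tame_vanish tame_part_x.
have [Jz [cz' vz]] := tame_vanish tz; have [Jw [cw' vw]] := tame_vanish tw.
pose d0 := euler_factor (q%:R^-1 : R) 1.
pose dC := euler_factor ((q%:R ^+ (m + 2))^-1 : R) (p * m).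
pose dB := euler_factor ((q%:R ^+ (p + n))^-1 : R) (n * p).
pose dA := euler_factor ((q%:R ^+ (p + l))^-1 : R) (p * l).
have rC N M : (N + (e + m + 1) <= M)%N -> vanish 0 N
    (dC * gen density M N - gen (fun M j => part_x M j + part_z M j + part_w M j) M N).
  by move=> NM; apply: rec_vanish => j jN; apply: density_rec; lia.
have rB N M : (N + cz <= M)%N -> vanish 0 N (dB * gen part_z M N - gen Sz M N).
  by move=> NM; apply: rec_vanish => j jN; apply: hz; lia.
have rA N M : (N + cw <= M)%N -> vanish 0 N (dA * gen part_w M N - gen Sw M N).
  by move=> NM; apply: rec_vanish => j jN; apply: hw; lia.
(* The bound J is left to unification. It is built from the sizes of the cofactors below and from
   the bounds of the tame parts, none of which involves N or M. *)
eexists; exists (e + m + 1 + cz + cw + cx + cz' + cw')%N => N M NM.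
(* The three recurrences are substituted into one another; every summand is a cofactor times a
   polynomial already known to vanish on a window. *)
have -> : denominator * gen density M N =
   d0 * dB * dA * (dC * gen density M N -
      gen (fun M j => part_x M j + part_z M j + part_w M j) M N) +
   (dB * dA * (d0 * gen part_x M N) +
   (d0 * dA * (dB * gen part_z M N - gen Sz M N) +
   (dA * (d0 * gen Sz M N) +
   (d0 * dB * (dA * gen part_w M N - gen Sw M N) +
    dB * (d0 * gen Sw M N))))).
  have -> : gen (fun M j => part_x M j + part_z M j + part_w M j) M N =
      gen part_x M N + gen part_z M N + gen part_w M N.
    by apply/polyP => i; rewrite !coefD !coef_poly; case: ifP => _; rewrite ?addr0.
  rewrite /denominator -/d0 -/dC -/dB -/dA; ring.
apply: vanishD; first by apply: vanishM; apply: rC; lia.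
apply: vanishD; first by apply: vanishM; apply: vx; lia.
apply: vanishD; first by apply: vanishM; apply: rB; lia.
apply: vanishD; first by apply: vanishM; apply: vz; lia.
apply: vanishD; first by apply: vanishM; apply: rA; lia.
by apply: vanishM; apply: vw; lia.
Qed.

End Recurrence.

(** * Haar integrals of locally constant functions *)

Section ApproxIntegral.
Local Open Scope classical_set_scope.
Context d (T : measurableType d) (R : realType).
Variables (mu : {measure set T -> \bar R}) (D : set T).
Hypothesis mD : measurable D.
Hypothesis muD : mu D = 1%E.

Lemma bounded_integrable (f : T -> R) c : measurable_fun D f ->
  (forall x, D x -> `|f x| <= c) -> mu.-integrable D (EFin \o f).
Proof.
move=> mf bf; apply: measurable_bounded_integrable => //.
  by rewrite muD ltry.
exists c; split; first exact: num_real.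
by move=> y cy x Dx; apply: le_trans (bf x Dx) (ltW cy).
Qed.

Lemma Rintegral_dist (f g : T -> R) b c : measurable_fun D f -> measurable_fun D g ->
  (forall x, D x -> `|f x| <= b) -> (forall x, D x -> `|g x| <= b) ->
  (forall x, D x -> `|f x - g x| <= c) ->
  `|Rintegral mu D f - Rintegral mu D g| <= c.
Proof.
move=> mf mg bf bg h.
have If := bounded_integrable mf bf; have Ig := bounded_integrable mg bg.
have mfg : measurable_fun D (f \- g) by exact: measurable_funB.
have Ifg : mu.-integrable D (EFin \o (f \- g)) by exact: (bounded_integrable mfg h).
rewrite -RintegralB//; apply: (le_trans (le_normr_Rintegral mD Ifg)).
have -> : c = Rintegral mu D (cst c) by rewrite Rintegral_cst// muD mulr1.
apply: le_Rintegral => //.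
  apply: (@bounded_integrable _ c); first exact: measurableT_comp.
  by move=> x Dx; rewrite normr_id; exact: h.
exact: (@bounded_integrable _ `|c|).
Qed.

(** Measurability of [F] comes from its being a pointwise limit of the [f N], and boundedness from
    the estimate at N = 0, where [f 0] is zero. *)
Lemma Rintegral_uniform_limit (F : T -> R) (f : nat -> T -> R) (C t : R) :
  0 <= t < 1 -> (forall N, measurable_fun D (f N)) -> (forall x, f 0%N x = 0) ->
  (forall N x, D x -> `|F x - f N x| <= C * t ^+ N) ->
  forall N, `|Rintegral mu D F - Rintegral mu D (f N)| <= C * t ^+ N.
Proof.
move=> /andP[t0 t1] mf f0 h N.
have mF : measurable_fun D F.
  apply: (measurable_fun_cvg mf) => x Dx.
  have /cvgrPdist_lt g0 : geometric C t @ \oo --> (0 : R).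
    by apply: cvg_geometric; rewrite ger0_norm.
  apply/cvgrPdist_lt => e e0; near=> n.
  apply: (le_lt_trans (h n x Dx)).
  have : `|0 - geometric C t n| < e by near: n; exact: g0.
  by apply: le_lt_trans; rewrite sub0r normrN ler_norm.
have bF x : D x -> `|F x| <= C.
  by move=> Dx; have := h 0%N x Dx; rewrite f0 subr0 expr0 mulr1.
apply: (@Rintegral_dist F (f N) (C + C * t ^+ N)) => //; last by move=> x; exact: h.
- move=> x Dx; apply: (le_trans (bF x Dx)); rewrite lerDl.
  exact: (le_trans _ (h N x Dx)).
- move=> x Dx; have -> : f N x = F x - (F x - f N x) by rewrite opprB addrC subrK.
  by apply: (le_trans (ler_normB _ _)); apply: lerD; [exact: bF|exact: h].
Unshelve. all: by end_near.
Qed.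

Lemma Rintegral_simple (I : eqType) (s : seq I) (A : I -> set T) (c : I -> R) :
  (forall i, measurable (A i)) -> (forall i, i \in s -> A i `<=` D) ->
  Rintegral mu D (fun x => \sum_(i <- s) c i * \1_(A i) x) =
  \sum_(i <- s) c i * fine (mu (A i)).
Proof.
move=> mA AD.
have mI i : measurable_fun D (\1_(A i) : T -> R) by exact: measurable_indic.
have I1 i : mu.-integrable D (EFin \o (\1_(A i) : T -> R)).
  apply: (@bounded_integrable _ 1) => // x _.
  by rewrite indicE; case: (_ \in _); rewrite ?normr1 ?normr0.
elim: s AD => [|i s IH] AD.
  under eq_Rintegral => x _ do rewrite big_nil.
  by rewrite Rintegral_cst// mul0r big_nil.
under eq_Rintegral => x _ do rewrite big_cons.
rewrite RintegralD//; last 2 first.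
- apply: (@bounded_integrable _ `|c i|).
    by apply: measurable_funM => //; exact: measurable_cst.
  move=> x _; rewrite normrM ler_piMr// indicE.
  by case: (_ \in _); rewrite ?normr1 ?normr0.
- apply: (@bounded_integrable _ (\sum_(i <- s) `|c i|)).
    by apply: measurable_sum => j; apply: measurable_funM => //; exact: measurable_cst.
  move=> x _; apply: (le_trans (ler_norm_sum _ _ _)); apply: ler_sum => j _.
  rewrite normrM ler_piMr// indicE.
  by case: (_ \in _); rewrite ?normr1 ?normr0.
rewrite big_cons IH; last by move=> j js; apply: AD; rewrite inE js orbT.
congr (_ + _); rewrite RintegralZl//; congr *%R.
by rewrite /Rintegral integral_indic// setIidl//; apply: AD; rewrite inE eqxx.
Qed.

End ApproxIntegral.

(** * Haar integrals on the polydisc as finite averages *)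

Section HaarMean.
Local Open Scope classical_set_scope.
Variables (R : realType) (K : fieldType) (p q : nat) (ord : K -> int) (pi : K).
Hypothesis HK : nonarch_local_field p q ord pi.
Variable rs : seq K.
Hypothesis rs_size : size rs = q.
Hypothesis rs_transversal : mod_transversal ord (in_OK ord) 1 rs.
Variable mu : {sigma_finite_measure set (Kmeas ord) -> \bar R}.
Hypothesis Hmu : haar_measure q mu.

Local Notation vl n x := (vle ord (n : nat)%:Z x).
Local Notation O x := (in_OK ord x).
Local Notation mean := (mean (R := R) q pi rs).
Local Notation mu3 := ((mu \x mu) \x mu)%E.

Definition mean3 M (F : K -> K -> K -> R) : R :=
  mean M (fun x => mean M (fun y => mean M (F x y))).

Lemma measurable_vball a m : measurable (vball ord a m : set (Kmeas ord)).
Proof. by apply: sub_sigma_algebra; exists a, m. Qed.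

Definition box (M : nat) (v : K * K * K) : set (Kmeas ord * Kmeas ord * Kmeas ord) :=
  ((vball ord v.1.1 M%:Z : set (Kmeas ord)) `*` (vball ord v.1.2 M%:Z : set (Kmeas ord)))
   `*` (vball ord v.2 M%:Z : set (Kmeas ord)).

Lemma measurable_box M v : measurable (box M v).
Proof.
by apply: measurableX; [apply: measurableX|]; exact: measurable_vball.
Qed.

Lemma boxP M v x : box M v x <->
  [/\ vl M ((x.1.1 : K) - v.1.1), vl M ((x.1.2 : K) - v.1.2) & vl M ((x.2 : K) - v.2)].
Proof. by split => [[[h1 h2] h3]|[h1 h2 h3]]; [split|do ! split]. Qed.

Lemma mu3_box M v : mu3 (box M v) = ((q%:R ^+ M)^-1 * (q%:R ^+ M)^-1 * (q%:R ^+ M)^-1)%:E.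
Proof.
have mv a : measurable (vball ord a M%:Z : set (Kmeas ord)) by exact: measurable_vball.
rewrite /box product_measure1E//; last exact: measurableX.
rewrite [X in (X * _)%E](_ : _ = mu (vball ord v.1.1 M%:Z) * mu (vball ord v.1.2 M%:Z))%E.
  by rewrite !Hmu -!exprnN.
exact: product_measure1E.
Qed.

Lemma OK3_box : OK3 ord = box 0 (0, 0, 0).
Proof.
apply/seteqP; split => x; rewrite boxP /= !subr0.
  by move=> [].
by move=> [].
Qed.

Lemma measurable_OK3 : measurable (OK3 ord).
Proof. by rewrite OK3_box; exact: measurable_box. Qed.

Lemma mu3_OK3 : mu3 (OK3 ord) = 1%E.
Proof. by rewrite OK3_box mu3_box expr0 invr1 !mulr1. Qed.

Definition grid M : seq (K * K * K) :=
  [seq (v, z) | v <- [seq (x, y) | x <- reps pi rs M, y <- reps pi rs M], z <- reps pi rs M].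

Lemma mean3_grid M (F : K -> K -> K -> R) : mean3 M F =
  \sum_(v <- grid M) F v.1.1 v.1.2 v.2 *
    ((q%:R ^+ M)^-1 * (q%:R ^+ M)^-1 * (q%:R ^+ M)^-1).
Proof.
rewrite /grid big_allpairs_dep big_allpairs_dep /= /mean3 /mean mulr_sumr.
apply: eq_bigr => x _; rewrite mulrA mulr_sumr; apply: eq_bigr => y _.
rewrite mulrA mulr_sumr; apply: eq_bigr => z _; by rewrite mulrC.
Qed.

Lemma gridP M v : v \in grid M ->
  [/\ v.1.1 \in reps pi rs M, v.1.2 \in reps pi rs M & v.2 \in reps pi rs M].
Proof.
by move=> /allpairsP[[? z] /= [/allpairsP[[x y] /= [hx hy ->]] hz ->]].
Qed.

(** The boxes around the grid points partition the polydisc and [F] is constant on each of them. On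
    the polydisc [F] is thus a finite combination of indicators of boxes of volume q^(-3M). *)
Lemma Rintegral_mod_periodic M (F : Kmeas ord * Kmeas ord * Kmeas ord -> R) :
  (forall u v, OK3 ord u -> box M v u -> OK3 ord v -> F u = F v) ->
  measurable_fun (OK3 ord) F /\
  Rintegral mu3 (OK3 ord) F = mean3 M (fun x y z => F (x, y, z)).
Proof.
move=> pF; have [ru rO ri rc] := reps_transversal HK rs_size rs_transversal M.
have gO v : v \in grid M -> OK3 ord v.
  by move=> /gridP[h1 h2 h3]; split; exact: rO.
have E u : OK3 ord u -> F u = \sum_(v <- grid M) F v * \1_(box M v) u.
  move=> Ou; have [Ox Oy Oz] := Ou.
  have [x hx vx] := rc _ Ox; have [y hy vy] := rc _ Oy; have [z hz vz] := rc _ Oz.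
  have ug : uniq (grid M).
    by rewrite !allpairs_uniq// => -[? ?] [? ?] _ _ [-> ->].
  have vg : (x, y, z) \in grid M.
    by apply/allpairsP; exists ((x, y), z); split=> //=; apply/allpairsP; exists (x, y).
  have ub : box M (x, y, z) u by apply/boxP.
  rewrite (bigD1_seq (x, y, z))//= big_seq_cond big1 ?addr0; last first.
    move=> v /andP[hv nv]; rewrite indicE memNset ?mulr0// => /boxP[h1 h2 h3].
    move/eqP: nv; apply; have [g1 g2 g3] := gridP hv.
    have W (a b c : K) : vl M (a - b) -> vl M (a - c) -> vl M (b - c).
      move=> hab hac; have -> : b - c = (a - c) - (a - b) by ring.
      exact: (vleB HK).
    rewrite [v]surjective_pairing [v.1]surjective_pairing.
    congr ((_, _), _); apply: ri => //.
    - exact: (W _ _ _ h1 vx).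
    - exact: (W _ _ _ h2 vy).
    - exact: (W _ _ _ h3 vz).
  by rewrite indicE mem_set// mulr1; apply: pF => //; exact: gO.
split.
  apply: (@eq_measurable_fun _ _ _ _ _ (fun u => \sum_(v <- grid M) F v * \1_(box M v) u)).
    by move=> u /set_mem Ou; rewrite E.
  apply: measurable_sum => v; apply: measurable_funM; first exact: measurable_cst.
  by apply: measurable_indic; exact: measurable_box.
rewrite (@eq_Rintegral _ _ _ _ _ (fun u => \sum_(v <- grid M) F v * \1_(box M v) u)).
  rewrite (Rintegral_simple measurable_OK3 mu3_OK3); last 2 first.
  - by move=> v; exact: measurable_box.
  - move=> v /gO[Ox Oy Oz] u /boxP[h1 h2 h3].
    have W (a b : K) : O b -> vl M (a - b) -> O a.
      by move=> hb h; have := vleD HK (vle_O h) hb; rewrite subrK.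
    by split; [exact: W h1|exact: W h2|exact: W h3].
  rewrite mean3_grid; apply: eq_bigr => v _.
  congr (_ * _); first by case: (v) => -[].
  exact: (congr1 fine (mu3_box M v)).
by move=> u /set_mem Ou; rewrite E.
Qed.

End HaarMean.

(** * The hybrid polynomial *)

Section ComplexPower.
Local Open Scope complex_scope.
Variable R : realType.
Implicit Types (z w s : R[i]).

Lemma qpow0 (a : R) : qpow a 0 = 1.
Proof. by rewrite /qpow /= !mul0r expR0 cos0 sin0 mul1r. Qed.

Lemma qpowD (a : R) z w : qpow a (z + w) = qpow a z * qpow a w.
Proof.
rewrite /qpow !raddfD/= !mulrDl expRD cosD sinD; simpc.
by congr (_ +i* _); ring.
Qed.

Lemma qpow_natM (a : R) (i : nat) s : qpow a (- (i%:Z%:~R * s)) = qpow a (- s) ^+ i.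
Proof.
elim: i => [|i IH]; first by rewrite mul0r oppr0 qpow0 expr0.
rewrite exprS -IH -qpowD; congr qpow.
by rewrite intS intrD mulrDl mul1r opprD.
Qed.

Lemma norm_real_complex (a : R) : `|a%:C| = `|a|%:C.
Proof. by rewrite normc_def /= expr0n addr0 sqrtr_sqr. Qed.

Lemma norm_qpow (a : R) z : `|qpow a z| = (expR (complex.Re z * ln a))%:C.
Proof.
rewrite /qpow normrM norm_real_complex (ger0_norm (expR_ge0 _)).
by rewrite normc_def /= cos2Dsin2 sqrtr1 mulr1.
Qed.

Lemma norm_Re_le z c : `|z| <= c%:C -> `|complex.Re z| <= c.
Proof. by rewrite -lecR; apply: le_trans; exact: normc_ge_Re. Qed.

Lemma norm_Im_le z c : `|z| <= c%:C -> `|complex.Im z| <= c.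
Proof.
rewrite -lecR; apply: le_trans; rewrite normc_def lecR -sqrtr_sqr ler_wsqrtr//.
by rewrite lerDr sqr_ge0.
Qed.

Lemma norm_recompose (a b c : R) : `|a| <= c -> `|b| <= c ->
  `|a%:C + 'i * b%:C| <= (2 * c)%:C.
Proof.
move=> ha hb; apply: (le_trans (ler_normD _ _)).
have -> : (2 * c)%:C = c%:C + c%:C by rewrite -raddfD/= mulr_natl.
apply: lerD; first by rewrite norm_real_complex lecR.
rewrite normrM norm_real_complex [`|'i|]normc_def/= expr0n expr1n add0r sqrtr1 mul1r.
by rewrite lecR.
Qed.

Lemma eq0_norm_geometric z (c t : R) : 0 <= t < 1 ->
  (forall N : nat, `|z| <= (c * t ^+ N)%:C) -> z = 0.
Proof.
move=> /andP[t0 t1] h; apply/eqP; rewrite -normr_eq0.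
pose a := Num.sqrt (complex.Re z ^+ 2 + complex.Im z ^+ 2).
have ha : `|z| = a%:C by exact: normc_def.
rewrite ha; suff -> : a = 0 by [].
apply/eqP; rewrite eq_le sqrtr_ge0 andbT leNgt; apply/negP => a0.
have /cvgrPdist_lt/(_ _ a0)[N _ hN] : (geometric c t @ \oo --> (0 : R))%classic.
  by apply: cvg_geometric; rewrite ger0_norm.
have := hN N (leqnn N); rewrite /= sub0r normrN => hlt.
have := h N; rewrite ha lecR leNgt => /negP; apply.
exact: le_lt_trans (ler_norm _) hlt.
Qed.

End ComplexPower.

(** * The substitution that turns g into h *)

Section HybridPolynomial.
Variables (R : realType) (K : fieldType) (p q : nat) (ord : K -> int) (pi : K).
Hypothesis HK : nonarch_local_field p q ord pi.
Variable rs : seq K.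
Hypothesis rs_size : size rs = q.
Hypothesis rs_transversal : mod_transversal ord (in_OK ord) 1 rs.
Variables (k l m e : nat) (t u : K).
Hypothesis pmE : (p * m = l + k.+1)%N.
Hypothesis u_unit : is_unitK ord u.
Hypothesis tuE : t ^+ k.+1 = u ^+ p.

Local Notation vl n x := (vle ord (n : nat)%:Z x).
Local Notation O x := (in_OK ord x).
Local Notation mean := (mean (R := R) q pi rs).
Local Notation mean3 := (@mean3 R K q pi rs).
Local Notation g := (hybrid_g p k l t).
Local Notation h := (poly_h p l k.+1).

Lemma hybrid_gE x y z : g x y z = h (x + u * z ^+ m) (t * z - y) z.
Proof.
have pp := pcharf_prime (char_K HK).
have frob (a b : K) : (a + b) ^+ p = a ^+ p + b ^+ p.
  by apply: exprDn_pchar; rewrite pnatE// (char_K HK).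
rewrite /hybrid_g /poly_h frob exprMn -exprM mulnC pmE -tuE.
(* Binomial expansion of ((t z - y) + y)^(k+1): the term of index 0 is the subtracted power, and
   every other term contains y. *)
have e1 : (t * z) ^+ k.+1 - (t * z - y) ^+ k.+1 =
  y * \sum_(i < k.+1) ('C(k.+1, i.+1))%:R * y ^+ i * (t * z - y) ^+ (k - i).
  rewrite -{1}(subrK y (t * z)) exprDn big_ord_recl bin0 mulr1n subn0 expr0 mulr1.
  rewrite addrC addKr mulr_sumr; apply: eq_bigr => i _.
  by rewrite /= /bump add1n subSS exprS -mulr_natl; ring.
rewrite [X in _ + X]mulrAC -e1 exprMn exprD; ring.
Qed.

Lemma t_unit : t != 0 /\ ord t = 0.
Proof.
have /andP[u0 /eqP ou] := u_unit.
have t0 : t != 0.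
  apply/eqP => t0; move: tuE; rewrite t0 expr0n/= => /esym/eqP.
  by rewrite expf_eq0 (negPf u0) andbF.
split=> //; have := congr1 ord tuE; rewrite !(ordX HK)// ou mul0rn => /eqP.
by rewrite mulrn_eq0/= => /eqP.
Qed.

Lemma Ot : O t.
Proof. by have [t0 ot] := t_unit; rewrite /in_OK vle_nz// ot. Qed.

Lemma Ou : O u.
Proof. by have /andP[u0 /eqP ou] := u_unit; rewrite /in_OK vle_nz// ou. Qed.

Lemma hybrid_g_congr M x y z x' y' z' :
  O x -> O y -> O z -> O x' -> O y' -> O z' ->
  vl M (x - x') -> vl M (y - y') -> vl M (z - z') -> vl M (g x y z - g x' y' z').
Proof.
move=> hx hy hz hx' hy' hz' h1 h2 h3; rewrite !hybrid_gE.
have Ouz a : O a -> O (u * a ^+ m) by move=> ha; apply: (OM HK); [exact: Ou|exact: (OX HK)].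
have Otz a : O a -> O (t * a) by move=> ha; apply: (OM HK) => //; exact: Ot.
apply: (poly_h_congr HK) => //.
- by apply: (vleD HK) => //; exact: Ouz.
- by apply: (vleB HK) => //; exact: Otz.
- by apply: (vleD HK) => //; exact: Ouz.
- by apply: (vleB HK) => //; exact: Otz.
- have -> : x + u * z ^+ m - (x' + u * z' ^+ m) = (x - x') + u * (z ^+ m - z' ^+ m) by ring.
  by apply: (vleD HK) => //; apply: (vleMl HK); [exact: Ou|exact: (vle_subX HK)].
- have -> : t * z - y - (t * z' - y') = t * (z - z') - (y - y') by ring.
  by apply: (vleB HK) => //; apply: (vleMl HK) => //; exact: Ot.
Qed.

Lemma hybrid_g_O x y z : O x -> O y -> O z -> O (g x y z).
Proof.
move=> hx hy hz; rewrite hybrid_gE; apply: (poly_h_O HK) => //.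
  by apply: (vleD HK) => //; apply: (OM HK); [exact: Ou|exact: (OX HK)].
by apply: (vleB HK) => //; apply: (OM HK) => //; exact: Ot.
Qed.

Variable r : K.

(** The substitution is made one coordinate at a time, y to t z - y with x and z fixed, then x to x
    + u z^m with z fixed. Each step is an isometry of O, and exchanging the means brings the moving
    coordinate innermost. *)
Lemma mean3_hybrid M j : (j + e <= M)%N ->
  mean3 M (fun x y z => in_ball R ord pi e r j (g x y z)) =
  density R p q ord pi rs l k.+1 e r M j.
Proof.
move=> jM.
have E := @eq_mean R _ _ _ _ _ HK _ rs_size rs_transversal.
pose H x w z := in_ball R ord pi e r j (h x w z).
have Hp x w z x' w' z' : O x -> O w -> O z -> O x' -> O w' -> O z' ->
    vl M (x - x') -> vl M (w - w') -> vl M (z - z') -> H x w z = H x' w' z'.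
  move=> *; congr (nat_of_bool _)%:R; apply: mem_vball_congr; first exact: HK.
  by apply: (@vle_trans _ _ M); [rewrite lez_nat|apply: (poly_h_congr HK)].
have v0 a : vl M (a - a) by rewrite subrr vle0.
have Oc z : O z -> O (u * z ^+ m).
  by move=> hz; apply: (OM HK); [exact: Ou|exact: (OX HK)].
have Otz z : O z -> O (t * z) by move=> hz; apply: (OM HK) => //; exact: Ot.
transitivity (mean3 M (fun x y z => H (x + u * z ^+ m) y z)).
  apply: (E) => x hx; rewrite mean_exchange [RHS]mean_exchange; apply: (E) => z hz.
  rewrite -(mean_map HK rs_size rs_transversal (F := fun y => H (x + u * z ^+ m) y z)
    (f := fun y => t * z - y)).
  - by apply: (E) => y hy; rewrite /H hybrid_gE.
  - move=> y y' hy hy' hyy; apply: Hp => //; by apply: (vleD HK) => //; exact: Oc.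
  - by move=> y hy; apply: (vleB HK) => //; exact: Otz.
  - move=> y y' _ _; have -> : t * z - y - (t * z - y') = - (y - y') by ring.
    by rewrite (vleN HK).
transitivity (mean3 M H).
  rewrite /mean3 mean_exchange [RHS]mean_exchange; apply: (E) => y hy.
  rewrite mean_exchange [RHS]mean_exchange; apply: (E) => z hz.
  rewrite (mean_map HK rs_size rs_transversal (F := fun x => H x y z)
    (f := fun x => x + u * z ^+ m))//.
  - by move=> x x' hx hx' hxx; apply: Hp.
  - by move=> x hx; apply: (vleD HK) => //; exact: Oc.
  - by move=> x x' _ _; rewrite opprD addrACA subrr addr0.
apply: (E) => x hx; rewrite ge_ord0// mul1r; apply: (E) => y hy.
rewrite ge_ord0// mul1r; apply: (E) => z hz.
by rewrite ge_ord0// mul1r.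
Qed.

End HybridPolynomial.

(** * The zeta function *)

Section PowerSeries.
Local Open Scope complex_scope.
Variable R : realType.

Lemma coefM_le (D P : {poly R[i]}) (b : R[i]) i : 0 <= b -> (forall j, `|P`_j| <= b) ->
  `|(D * P)`_i| <= \sum_(a < size D) `|D`_a| * b.
Proof.
move=> b0 hP; rewrite -{1}(coefK D) poly_def mulr_suml coef_sum.
apply: (le_trans (ler_norm_sum _ _ _)); apply: ler_sum => a _.
rewrite -scalerAl coefZ normrM ler_wpM2l// coefXnM.
by case: ifP => _; rewrite ?normr0.
Qed.

(** With P the truncation at N, the coefficients of D P below J are those of the claimed numerator,
    those from J to N vanish, and at most size D further ones remain, bounded uniformly and
    multiplied by powers of T of exponent at least N. The two sides differ by O(t^N) for every large
    N, hence agree. *)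
Lemma series_rational (D : {poly R[i]}) (c : nat -> R[i]) J (b b' t : R) (T Z : R[i]) :
  `|T| = t%:C -> 0 <= t < 1 ->
  (forall N, vanish J N (D * \poly_(j < N) c j)) ->
  (forall j, `|c j| <= b%:C) ->
  (forall N, `|Z - (\poly_(j < N) c j).[T]| <= (b' * t ^+ N)%:C) ->
  D.[T] * Z = (\poly_(i < J) (D * \poly_(j < J) c j)`_i).[T].
Proof.
move=> hT t01 hv hc hZ; have /andP[t0 t1] := t01.
have b0 : 0 <= b%:C by exact: le_trans (normr_ge0 _) (hc 0%N).
pose be := \sum_(a < size D) `|D`_a| * b%:C.
pose ka := `|D.[T]| * b'%:C + be *+ size D.
have real_norm (z : R[i]) : (complex.Re `|z|)%:C = `|z| by rewrite RRe_real// normr_real.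
have kaE : ka = (complex.Re ka)%:C.
  rewrite RRe_real// rpredD ?rpredM ?normr_real//; first by apply/complex_realP; exists b'.
  by rewrite rpredMn// rpred_sum// => a _; rewrite rpredM ?normr_real// ger0_real.
apply/eqP; rewrite -subr_eq0; apply/eqP.
(* The factor t^J pays for shifting the index by J, which ensures J <= N. *)
apply: (@eq0_norm_geometric _ _ (complex.Re ka * t ^+ J) t) => // N0.
set N := (N0 + J)%N.
have -> : (complex.Re ka * t ^+ J * t ^+ N0)%:C = ka * t%:C ^+ N.
  by rewrite {2}kaE -rmorphXn -rmorphM/= -mulrA -exprD addnC.
set P := \poly_(j < N) c j; set Q := D * P.
have QT : Q.[T] = \sum_(0 <= i < N + size D) Q`_i * T ^+ i.
  rewrite big_mkord; apply: horner_coef_wide.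
  apply: (leq_trans (size_polyMleq _ _)); rewrite addnC.
  apply: (leq_trans (leq_pred _)); rewrite leq_add2r; exact: size_poly.
have JN : (J <= N)%N by exact: leq_addl.
have LT : (\poly_(i < J) (D * \poly_(j < J) c j)`_i).[T] = \sum_(0 <= i < J) Q`_i * T ^+ i.
  rewrite horner_poly big_mkord; apply: eq_bigr => i _; congr (_ * _).
  rewrite !coefM; apply: eq_bigr => a _; congr (_ * _); rewrite !coef_poly.
  have ia : (i - a < J)%N by apply: leq_ltn_trans (leq_subr _ _) (ltn_ord i).
  by rewrite ia (leq_trans ia).
have -> : D.[T] * Z - (\poly_(i < J) (D * \poly_(j < J) c j)`_i).[T] =
    D.[T] * (Z - P.[T]) + (Q.[T] - \sum_(0 <= i < J) Q`_i * T ^+ i).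
  by rewrite LT /Q hornerM; ring.
rewrite /ka mulrDl; apply: (le_trans (ler_normD _ _)); apply: lerD.
  rewrite normrM -mulrA ler_wpM2l//; apply: (le_trans (hZ N)).
  by rewrite -rmorphXn -rmorphM/=.
(* The range of summation is cut at J and at N: cancellation below J, zeros up to N, boundary terms
   of the truncation after N. *)
rewrite QT (big_cat_nat (n := J))//=; last exact: leq_trans (leq_addr _ _).
rewrite addrAC subrr add0r (big_cat_nat (n := N)) ?leq_addr//=.
rewrite big_nat_cond big1 ?add0r; last first.
  by move=> i /andP[/andP[h1 h2] _]; rewrite hv// mul0r.
rewrite -{1}[N]add0n big_addn addKn big_mkord.
apply: (le_trans (ler_norm_sum _ _ _)).
have -> : be *+ size D * t%:C ^+ N = \sum_(i < size D) be * t%:C ^+ N.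
  by rewrite sumr_const card_ord mulrnAl.
apply: ler_sum => i _; rewrite normrM; apply: ler_pM => //.
  apply: coefM_le => // j; rewrite coef_poly.
  by case: ifP => _; rewrite ?normr0.
rewrite normrX hT -!rmorphXn/= lecR exprD ler_piMl ?exprn_ge0// exprn_ile1// ltW//.
Qed.

Lemma euler_factor_neq0 (a : R) d (T : R[i]) : 0 <= a <= 1 -> (0 < d)%N -> `|T| < 1 ->
  1 - a%:C * T ^+ d != 0.
Proof.
move=> /andP[a0 a1] d0 T1; rewrite subr_eq0; apply/eqP => e1.
have : `|a%:C * T ^+ d| < 1.
  rewrite normrM norm_real_complex (ger0_norm a0) normrX.
  apply: (@le_lt_trans _ _ (`|T| ^+ d)).
    by rewrite ler_piMl ?exprn_ge0// lecR.
  by rewrite exprn_ilt1 -?lt0n//.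
by rewrite -e1 normr1 ltxx.
Qed.

Lemma horner_euler_factor (a : R) d (T : R[i]) :
  (map_poly (real_complex R) (euler_factor a d)).[T] = 1 - a%:C * T ^+ d.
Proof.
by rewrite /euler_factor rmorphB rmorph1 /= map_polyZ map_polyXn !hornerE.
Qed.

End PowerSeries.

(** * The zeta integral as the sum of a power series *)

Section Zeta.
Local Open Scope complex_scope.
Variables (R : realType) (K : fieldType) (p q : nat) (ord : K -> int) (pi : K).
Hypothesis HK : nonarch_local_field p q ord pi.
Variable rs : seq K.
Hypothesis rs_size : size rs = q.
Hypothesis rs_transversal : mod_transversal ord (in_OK ord) 1 rs.
Variable mu : {sigma_finite_measure set (Kmeas ord) -> \bar R}.
Hypothesis Hmu : haar_measure q mu.
Variables (k l m e : nat) (t u : K).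
Hypothesis l_unit : is_unitK ord (l%:R : K).
Hypothesis pmE : (p * m = l + k.+1)%N.
Hypothesis e_gt0 : (0 < e)%N.
Hypothesis u_unit : is_unitK ord u.
Hypothesis tuE : t ^+ k.+1 = u ^+ p.
Variable chi : K -> R[i].
Hypothesis chiM : forall a b, is_unitK ord a -> is_unitK ord b -> chi (a * b) = chi a * chi b.
Hypothesis chi1 : forall a, is_unitK ord a -> vle ord e%:Z (a - 1) -> chi a = 1.

Local Notation vl n x := (vle ord (n : nat)%:Z x).
Local Notation O x := (in_OK ord x).
Local Notation mean3 := (@mean3 R K q pi rs).
Local Notation mu3 := ((mu \x mu) \x mu)%E.
Local Notation ball := (in_ball R ord pi e).
Local Notation density := (density R p q ord pi rs l k.+1 e).

Definition gv (v : Kmeas ord * Kmeas ord * Kmeas ord) : K :=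
  hybrid_g p k l t v.1.1 v.1.2 v.2.

Definition unit_reps : seq K := [seq r <- reps pi rs e | is_unitK ord r].

Definition vol (r : K) (j : nat) : R := Rintegral mu3 (OK3 ord) (fun v => ball r j (gv v)).

(** The integral of chi (ac g) over the set where ord g = j, that is, the coefficient of T^j in the
    zeta function. *)
Definition zcoef (j : nat) : R[i] := \sum_(r <- unit_reps) chi r * (vol r j)%:C.

(** A sum rather than a maximum: it bounds each value of chi on [unit_reps] and, volumes being at
    most 1, also each coefficient [zcoef j]. *)
Definition chi_bound : R := \sum_(r <- unit_reps) complex.Re `|chi r|.

Lemma chi_boundE : chi_bound%:C = \sum_(r <- unit_reps) `|chi r|.
Proof.
rewrite /chi_bound rmorph_sum; apply: eq_bigr => r _.
exact: (RRe_real (normr_real _)).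
Qed.

Lemma chi_bound_ge r : r \in unit_reps -> `|chi r| <= chi_bound%:C.
Proof.
move=> hr; rewrite chi_boundE (big_rem r)//= lerDl.
exact: sumr_ge0.
Qed.

Lemma chi_bound_ge0 : 0 <= chi_bound.
Proof. by rewrite -lecR chi_boundE sumr_ge0. Qed.

Lemma OK3_gv v : OK3 ord v -> O (gv v).
Proof. by case=> h1 h2 h3; exact: (hybrid_g_O HK pmE u_unit tuE). Qed.

Lemma gv_congr M x y : OK3 ord x -> OK3 ord y -> box M y x -> vl M (gv x - gv y).
Proof.
move=> [h1 h2 h3] [h1' h2' h3'] /boxP[c1 c2 c3].
exact: (hybrid_g_congr HK pmE u_unit tuE).
Qed.

Lemma ball_gv_congr M r j x y : (j + e <= M)%N ->
  OK3 ord x -> box M y x -> OK3 ord y -> ball r j (gv x) = ball r j (gv y).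
Proof.
move=> jM Ox bx Oy; congr (nat_of_bool _)%:R; apply: (mem_vball_congr HK).
by apply: (@vle_trans _ _ M%:Z); [rewrite lez_nat|exact: gv_congr].
Qed.

Lemma vol_density r M j : (j + e <= M)%N -> vol r j = density r M j.
Proof.
move=> jM; rewrite -(mean3_hybrid _ HK rs_size rs_transversal pmE u_unit tuE)//.
have [_] := Rintegral_mod_periodic HK rs_size rs_transversal Hmu
  (M := M) (F := fun v => ball r j (gv v)) (fun x y Ox bx Oy => ball_gv_congr r jM Ox bx Oy).
exact.
Qed.

Lemma norm_vol r j : `|vol r j| <= 1.
Proof.
have [mF _] := Rintegral_mod_periodic HK rs_size rs_transversal Hmu
  (M := j + e) (F := fun v => ball r j (gv v))
  (fun x y Ox bx Oy => ball_gv_congr r (leqnn _) Ox bx Oy).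
have mO : measurable (OK3 ord) by exact: measurable_OK3.
have b1 x : `|ball r j x| <= 1.
  by rewrite /in_ball; case: (mem_vball _ _ _ _ _ _); rewrite ?normr1 ?normr0.
have := @Rintegral_dist _ _ _ mu3 _ mO (mu3_OK3 Hmu) (fun v => ball r j (gv v)) (cst 0) 1 1
  mF (measurable_cst _) (fun x _ => b1 _).
rewrite Rintegral_cst// mul0r subr0; apply => x _; first by rewrite normr0.
by rewrite subr0; exact: b1.
Qed.

Lemma norm_zcoef j : `|zcoef j| <= chi_bound%:C.
Proof.
rewrite chi_boundE; apply: (le_trans (ler_norm_sum _ _ _)); apply: ler_sum => r _.
by rewrite normrM norm_real_complex ler_piMr// lecR norm_vol.
Qed.

Lemma density_vanish_seq (s : seq K) : {in s, forall r, is_unitK ord r} ->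
  exists J c, forall N M, (N + c <= M)%N -> {in s, forall r,
    vanish J N (denominator R p q l k.+1 m * gen (density r) M N)}.
Proof.
elim: s => [|r s IH] hs; first by exists 0%N, 0%N.
have [r' hr'|J [c h]] := IH; first by apply: hs; rewrite inE hr' orbT.
have ru : is_unitK ord r by apply: hs; rewrite inE eqxx.
have [J' [c' h']] := density_vanish R HK rs_size rs_transversal l_unit (ltn0Sn k) pmE e_gt0 ru.
exists (J + J')%N, (c + c')%N => N M NM r'; rewrite inE => /orP[/eqP->|hr'].
  apply: (vanish_le (J := J')); first exact: leq_addl.
  by apply: h'; apply: leq_trans NM; rewrite leq_add2l leq_addl.
apply: (vanish_le (J := J)); first exact: leq_addr.
by apply: h => //; apply: leq_trans NM; rewrite leq_add2l leq_addr.
Qed.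

Lemma zcoef_vanish : exists J, forall N,
  vanish J N (map_poly (real_complex R) (denominator R p q l k.+1 m) * \poly_(j < N) zcoef j).
Proof.
have [|J [c h]] := @density_vanish_seq unit_reps.
  by move=> r; rewrite mem_filter => /andP[].
(* One level valid for all the volumes of index j < N and all r at once. *)
exists J => N i Ji iN; pose M := (N + c + e)%N.
transitivity (\sum_(r <- unit_reps) chi r *
    ((denominator R p q l k.+1 m * gen (density r) M N)`_i)%:C); last first.
  rewrite big_seq big1// => r hr; rewrite (h N M) ?mulr0//.
  by rewrite /M leq_addr.
rewrite coefM.
under eq_bigr => a _.
  rewrite coef_map coef_poly.
  have -> : (i - a < N)%N by apply: leq_ltn_trans (leq_subr _ _) iN.
  rewrite /zcoef mulr_sumr; over.
rewrite exchange_big; apply: eq_bigr => r _ /=.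
rewrite coefM rmorph_sum mulr_sumr; apply: eq_bigr => a _ /=.
have ia : (i - a < N)%N by apply: leq_ltn_trans (leq_subr _ _) iN.
rewrite mulrCA; congr (_ * _); rewrite rmorphM/=; congr (_ * _%:C).
rewrite coef_poly ia; apply: vol_density; rewrite /M -addnA; apply: leq_add; first exact: ltnW.
exact: leq_addl.
Qed.

Variable s : R[i].
Hypothesis s_gt0 : 0 < complex.Re s.

Local Notation T := (qpow (q%:R : R) (- s)).
Local Notation tau := (expR (complex.Re (- s) * ln (q%:R : R))).

Lemma tau_bound : 0 <= tau < 1.
Proof.
rewrite expR_ge0/= -[X in _ < X]expR0 ltr_expR raddfN mulNr oppr_lt0 mulr_gt0// ln_gt0//.
by rewrite ltr1n; exact: (q_gt1 HK rs_size rs_transversal).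
Qed.

Lemma norm_T : `|T| = tau%:C. Proof. exact: norm_qpow. Qed.

Definition zterm (x : K) : R[i] := chi0 chi (ac ord pi x) * abs_pow q ord x s.

(** The part of the integrand supported on ord x < N, a finite combination of indicators of
    balls. *)
Definition zapprox N (x : K) : R[i] :=
  \sum_(j < N) T ^+ j * \sum_(r <- unit_reps) chi r * (ball r j x)%:C.

(** A nonzero x lies in exactly one of the balls: the one with j = ord x and r congruent to ac x
    modulo pi^e. *)
Lemma zapproxE x : O x -> x != 0 -> exists r i, [/\ r \in unit_reps,
  zterm x = T ^+ i * chi r &
  forall N, zapprox N x = if (i < N)%N then T ^+ i * chi r else 0].
Proof.
move=> Ox x0.
have [i oi] : exists i : nat, ord x = i.
  by move: Ox; rewrite /in_OK vle_nz//; case: (ord x) => // i _; exists i.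
pose a := ac ord pi x.
have aE : x = pi ^+ i * a.
  by rewrite /a /ac oi -exprnN mulrCA mulfV ?mulr1// (piX0 HK).
have a0 : a != 0 by apply: contraNneq x0 => a0; rewrite aE a0 mulr0.
have oa : ord a = 0.
  apply: (addrI i%:Z); rewrite addr0 -[RHS]oi aE (ordM HK) ?(piX0 HK)//.
  by rewrite (ord_piX HK).
have [ru rO ri rc] := reps_transversal HK rs_size rs_transversal e.
have Oa : O a by rewrite /in_OK vle_nz// oa.
have [r hr har] := rc a Oa.
have [r0 or] : r != 0 /\ ord r = 0.
  rewrite -oa; apply: (ord_congr HK) => //; rewrite oa add0r (vle_distC HK).
  by apply: vle_trans har; rewrite lez_nat.
have runit : is_unitK ord r by rewrite /is_unitK r0 or eqxx.
have rU : r \in unit_reps by rewrite mem_filter runit.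
have ballE j r' : r' \in unit_reps -> ball r' j x = ((j == i) && (r' == r))%:R.
  rewrite mem_filter => /andP[r'u r'r]; congr (nat_of_bool _)%:R.
  have nb r1 : is_unitK ord r1 -> mem_vball ord pi e r1 i x = vl e (a - r1).
    by move=> _; rewrite -(addn0 i) aE (mem_vball_pi HK) /mem_vball add0n expr0 mul1r.
  apply/idP/andP => [h|[/eqP-> /eqP->]]; last by rewrite nb.
  have [_ oj] := mem_vball_ord HK e_gt0 r'u h.
  have ji : j = i by move: oj; rewrite oi => -[].
  split; first exact/eqP.
  rewrite ji nb// in h; apply/eqP; apply: ri => //.
  have -> : r' - r = (a - r) - (a - r') by ring.
  exact: (vleB HK).
(* The quotient a / r is a unit congruent to 1 modulo pi^e, where chi is trivial. *)
have chia : chi a = chi r.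
  have ar0 : a / r != 0 by rewrite mulf_neq0 ?invr_eq0.
  have oar : ord (a / r) = 0 by rewrite (ordM HK) ?invr_eq0// (ordV HK)// oa or subr0.
  have -> : a = r * (a / r) by rewrite mulrC divfK.
  have aru : is_unitK ord (a / r) by rewrite /is_unitK ar0 oar eqxx.
  rewrite chiM// (chi1 aru) ?mulr1//.
  have -> : a / r - 1 = r^-1 * (a - r) by field.
  apply: (vleMl HK) => //.
  by rewrite /in_OK vle_nz ?invr_eq0// (ordV HK)// or.
exists r, i; split=> //.
  rewrite /zterm /chi0 -/a (negPf a0) chia /abs_pow (negPf x0) oi.
  by rewrite -[i%:~R]/(i%:Z%:~R) qpow_natM mulrC.
move=> N; rewrite /zapprox.
transitivity (\sum_(j < N) if j == i :> nat then T ^+ i * chi r else 0).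
  apply: eq_bigr => j _; rewrite big_seq.
  under eq_bigr => r' hr' do rewrite ballE//.
  rewrite -big_seq; case: eqP => [ji|_]; last first.
    by rewrite big1 ?mulr0// => r' _; rewrite /= mulr0.
  rewrite ji; congr (_ * _); rewrite (bigD1_seq r)//=; last exact: filter_uniq.
  rewrite eqxx mulr1 big1 ?addr0// => r' /negPf->.
  by rewrite /= mulr0.
case: ltnP => iN; last first.
  by rewrite big1// => j _; case: eqP => // ji; move: (ltn_ord j); rewrite ji ltnNge iN.
rewrite (bigD1 (Ordinal iN))//= eqxx big1 ?addr0// => j /negPf nj.
by case: eqP => // ji; move/negP: (negbT nj); case; apply/eqP/val_inj.
Qed.

(** At x = 0 both terms are zero by the convention on |0|^s. Otherwise the approximation is exact
    for ord x < N, and for ord x >= N it is zero while the integrand has size at most [chi_bound]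
    times tau^N. *)
Lemma zapprox_dist N x : O x -> `|zterm x - zapprox N x| <= (chi_bound * tau ^+ N)%:C.
Proof.
move=> Ox; have /andP[t0 t1] := tau_bound.
have [->|x0] := eqVneq x 0.
  have -> : zterm 0 = 0 by rewrite /zterm /abs_pow eqxx mulr0.
  rewrite /zapprox big1 ?subrr ?normr0 ?ler0c ?mulr_ge0 ?exprn_ge0 ?chi_bound_ge0//.
  move=> j _; rewrite big_seq big1 ?mulr0// => r; rewrite mem_filter => /andP[ru _].
  rewrite in_ball_eq0 ?mulr0//; apply/negP => /(mem_vball_ord HK e_gt0 ru)[].
  by rewrite eqxx.
have [r [i [rU -> ->]]] := zapproxE Ox x0.
case: ltnP => iN; first by rewrite subrr normr0 ler0c mulr_ge0 ?exprn_ge0 ?chi_bound_ge0.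
rewrite subr0 normrM normrX norm_T -rmorphXn mulrC rmorphM/=.
apply: ler_pM => //; first by rewrite ler0c exprn_ge0.
  exact: chi_bound_ge.
by rewrite lecR ler_wiXn2l// ltW.
Qed.

Lemma mean3_lin (I : Type) (w : seq I) M (a : I -> R) (F : I -> K -> K -> K -> R) :
  mean3 M (fun x y z => \sum_(i <- w) a i * F i x y z) =
  \sum_(i <- w) a i * mean3 M (F i).
Proof.
rewrite mean3_grid; under [RHS]eq_bigr do rewrite mean3_grid mulr_sumr.
rewrite exchange_big; apply: eq_bigr => v _; rewrite mulr_suml.
by apply: eq_bigr => i _; rewrite mulrA.
Qed.

(** [phi] will be the real part and the imaginary part, through which the complex integral is
    defined; the hypotheses are what the common argument uses. *)
Lemma Rintegral_zterm (phi : R[i] -> R) :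
  (forall (I : Type) (w : seq I) (F : I -> R[i]),
    phi (\sum_(i <- w) F i) = \sum_(i <- w) phi (F i)) ->
  (forall z w, phi (z - w) = phi z - phi w) ->
  (forall z a, phi (z * a%:C) = phi z * a) ->
  (forall z c, `|z| <= c%:C -> `|phi z| <= c) ->
  forall N, `|Rintegral mu3 (OK3 ord) (fun v => phi (zterm (gv v))) -
    phi (\poly_(j < N) zcoef j).[T]| <= chi_bound * tau ^+ N.
Proof.
move=> phiS phiB phiZ phi_le N.
have phiA n x : phi (zapprox n x) =
    \sum_(j < n) \sum_(r <- unit_reps) phi (T ^+ j * chi r) * ball r j x.
  rewrite phiS; apply: eq_bigr => j _; rewrite mulr_sumr phiS.
  by apply: eq_bigr => r _; rewrite mulrA phiZ.
have per n := Rintegral_mod_periodic HK rs_size rs_transversal Hmu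
  (M := n + e) (F := fun v => phi (zapprox n (gv v))).
have {}per n : measurable_fun (OK3 ord) (fun v => phi (zapprox n (gv v))) /\
    Rintegral mu3 (OK3 ord) (fun v => phi (zapprox n (gv v))) =
    mean3 (n + e) (fun x y z => phi (zapprox n (gv (x, y, z)))).
  apply: per => x y Ox bx Oy; rewrite !phiA; apply: eq_bigr => j _.
  apply: eq_bigr => r _; congr (_ * _); apply: (ball_gv_congr _ (M := n + e)) => //.
  by rewrite leq_add2r ltnW.
have <- : Rintegral mu3 (OK3 ord) (fun v => phi (zapprox N (gv v))) =
    phi (\poly_(j < N) zcoef j).[T].
  rewrite (per N).2 horner_poly phiS.
  transitivity (mean3 (N + e) (fun x y z => \sum_(j < N) 1 *
     \sum_(r <- unit_reps) phi (T ^+ j * chi r) * ball r j (gv (x, y, z)))).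
    congr mean3; apply/funext => x; apply/funext => y; apply/funext => z.
    by rewrite phiA; apply: eq_bigr => j _; rewrite mul1r.
  rewrite mean3_lin; apply: eq_bigr => j _; rewrite mul1r mean3_lin.
  rewrite [X in _ = phi X]mulrC /zcoef mulr_sumr phiS; apply: eq_bigr => r _.
  rewrite [in RHS]mulrA phiZ; congr (_ * _).
  have jN : (j + e <= N + e)%N by rewrite leq_add2r ltnW.
  by rewrite (vol_density _ jN) -(mean3_hybrid _ HK rs_size rs_transversal pmE u_unit tuE).
apply: (Rintegral_uniform_limit (@measurable_OK3 K ord) (mu3_OK3 Hmu) tau_bound
  (f := fun n v => phi (zapprox n (gv v)))).
- by move=> n; case: (per n).
- by move=> x; rewrite phiA big_ord0.
- move=> n x Ox; rewrite -phiB; apply: phi_le; apply: zapprox_dist.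
  exact: OK3_gv.
Qed.

Lemma zeta_approx N : `|igusa_zeta3 q pi mu (hybrid_g p k l t) chi s -
    (\poly_(j < N) zcoef j).[T]| <= (2 * chi_bound * tau ^+ N)%:C.
Proof.
rewrite /igusa_zeta3 /cintegral.
set A := Rintegral _ _ _; set B := Rintegral _ _ _; set S := _.[T].
have -> : A%:C + 'i * B%:C - S =
    (A - complex.Re S)%:C + 'i * (B - complex.Im S)%:C.
  by rewrite {1}[S]complexE complexiE !raddfB/=; ring.
rewrite -mulrA; apply: norm_recompose.
- apply: (Rintegral_zterm (phi := @complex.Re R)).
  + by move=> I w F; rewrite raddf_sum.
  + by move=> z w; rewrite raddfB.
  + by move=> [a b] c /=; rewrite mulr0 subr0.
  + exact: norm_Re_le.
- apply: (Rintegral_zterm (phi := @complex.Im R)).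
  + by move=> I w F; rewrite raddf_sum.
  + by move=> z w; rewrite raddfB.
  + by move=> [a b] c /=; rewrite mulr0 add0r.
  + exact: norm_Im_le.
Qed.

End Zeta.

Local Open Scope complex_scope.

Theorem theorem1p2
  (R : realType) (K : fieldType) (p q : nat) (ord : K -> int) (pi : K)
  (HK : nonarch_local_field p q ord pi)
  (mu : {sigma_finite_measure set (Kmeas ord) -> \bar R})
  (Hmu : haar_measure q mu)
  (k l : nat) (hk : (0 < k)%N) (hl : (1 < l)%N)
  (hpl : ~~ (p %| l)%N) (hpkl : (p %| k + l + 1)%N) (hlbar : (1 + l %% p <= p)%N)
  (t : K) (ht : exists u : K, is_unitK ord u /\ t ^+ k.+1 = u ^+ p)
  (chi : K -> R[i]) (hchi : mult_character ord chi) :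
  exists L : {poly R[i]},
    forall s : R[i], 0 < complex.Re s ->
      let T := qpow (q%:R : R) (- s) in
      igusa_zeta3 q pi mu (hybrid_g p k l t) chi s =
        L.[T] /
        ((1 - (q%:R : R[i])^-1 * T)
         * (1 - (q%:R : R[i]) ^- ((k + l + 1) %/ p + 2) * T ^+ (k + l + 1))
         * (1 - (q%:R : R[i]) ^- (p + k.+1) * T ^+ (k.+1 * p))
         * (1 - (q%:R : R[i]) ^- (p + l) * T ^+ (p * l))).
Proof.
have [rs [rs_size rs_O rs_uniq rs_inj rs_cov]] := residue_card HK.
have rs_tr : mod_transversal ord (in_OK ord) 1 rs.
  by split=> //; apply/allP.
have [u [u_unit tuE]] := ht.
have [chiM _ [e chi1]] := hchi.
have l_unit := ord_natr HK hpl.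
pose m := ((k + l + 1) %/ p)%N.
have pmE : (p * m = l + k.+1)%N by rewrite mulnC divnK// addn1 addnS (addnC l).
(* Passing to e + 1 makes the exponent positive, so that each ball has a well-defined order; chi
   remains trivial on the smaller group. *)
have chi1' a : is_unitK ord a -> vle ord e.+1%:Z (a - 1) -> chi a = 1.
  by move=> au h; apply: chi1 => //; apply: vle_trans h; rewrite lez_nat.
have [J hJ] := zcoef_vanish HK rs_size rs_tr Hmu l_unit pmE (ltn0Sn e) u_unit tuE chi.
(* The numerator is the part of degree below J of denominator times series. It is built from the
   coefficients alone, hence does not depend on s. *)
exists (\poly_(i < J) (map_poly (real_complex R) (denominator R p q l k.+1 m) *
  \poly_(j < J) zcoef p pi rs mu k l e.+1 t chi j)`_i) => s s0 T.
have q1 := q_gt1 HK rs_size rs_tr.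
have /andP[t0 t1] := tau_bound HK rs_size rs_tr s0.
have T1 : `|T| < 1 by rewrite norm_qpow ltcR.
have p0 : (0 < p)%N by exact/prime_gt0/(pcharf_prime (char_K HK)).
have := series_rational (norm_qpow _ _) (tau_bound HK rs_size rs_tr s0) hJ
  (norm_zcoef HK rs_size rs_tr Hmu e.+1 pmE u_unit tuE chi)
  (zeta_approx HK rs_size rs_tr Hmu pmE (ltn0Sn e) u_unit tuE chiM chi1' s0).
move=> <-.
have DE : (map_poly (real_complex R) (denominator R p q l k.+1 m)).[T] =
    (1 - (q%:R : R[i])^-1 * T)
         * (1 - (q%:R : R[i]) ^- ((k + l + 1) %/ p + 2) * T ^+ (k + l + 1))
         * (1 - (q%:R : R[i]) ^- (p + k.+1) * T ^+ (k.+1 * p))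
         * (1 - (q%:R : R[i]) ^- (p + l) * T ^+ (p * l)).
  rewrite /denominator !rmorphM/= !hornerM !horner_euler_factor.
  rewrite !fmorphV !rmorphXn !rmorph_nat expr1.
  have e1 : (k + l + 1 = l + k.+1)%N by rewrite addn1 addnS (addnC l).
  by rewrite pmE -/m -e1.
have qV a : 0 <= (q%:R ^+ a : R)^-1 <= 1.
  rewrite invr_ge0 exprn_ge0//= invf_le1 ?exprn_gt0 ?ltr0n ?(ltnW q1)//.
  by rewrite exprn_ege1// ler1n ltnW.
(* As |T| < 1 for Re s > 0, no factor of the denominator vanishes at T. *)
have D0 : (map_poly (real_complex R) (denominator R p q l k.+1 m)).[T] != 0.
  rewrite /denominator !rmorphM/= !hornerM !horner_euler_factor.
  rewrite -[q%:R^-1]/((q%:R ^+ 1)^-1) !mulf_neq0 ?euler_factor_neq0//.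
  - by rewrite pmE addnS.
  - by rewrite muln_gt0 p0.
  - by rewrite muln_gt0 p0 (ltn_trans _ hl).
by rewrite -DE mulrC mulKf.
Qed.
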